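(* Any quantization morphism $\underline{Q}:\underline{\mathrm{QUE}}_{\mathrm{QT}}\to\underline{\mathrm{UE}}_{\mathrm{qt}}[[\hbar]]$ is a prop isomorphism.
   Context: Conventions. $\mathbb{K}$ is a field of characteristic zero, $\hbar$ a formal variable, $R_0$ is $\mathbb{K}$ or $\mathbb{K}[[\hbar]]$. All $\mathbb{K}[[\hbar]]$-modules are quotients of topologically free modules by closed submodules; direct sums and tensor products are taken in this (completed) category and maps are continuous. A prop $\underline{P}$ over $R_0$ is the collection of $R_0$-modules $\underline{P}(n,m)=\mathrm{Hom}(O^{\otimes n},O^{\otimes m})$ of a strict symmetric monoidal $R_0$-linear category with objects $O^{\otimes n}$, $n\ge0$, with composition $\circ$, tensor product $\otimes$ and maps $\mathbb{Q}\mathfrak{S}_n\to\underline P(n,n)$; elements of $\underline P(n,m)$ have bidegree $(n,m)$. $(i_1\ldots i_k)$ is the permutation $a\mapsto i_a$ (moving factor $a$ to position $i_a$). If $x_i\in\underline P(0,n_i)$ and $I_1,\dots,I_p$ are ordered sets partitioning $[1,\sum n_i]$ with $|I_i|=n_i$, then $x_1^{I_1}\cdots x_p^{I_p}$ is $x_1\otimes\cdots\otimes x_p$ with the components of $x_i$ moved to the positions $I_i$ in order. $\underline P[[\hbar]](p,q)=\underline P(p,q)[[\hbar]]$; the torsion ideal is the collection of torsion submodules; $\underline P\langle x_i\rangle/(\text{relations})$ is obtained by adjoining generators and relations. The completion of $\underline P$ with respect to a decreasing family of ideals $I_n$ is $\varprojlim_n\underline P(p,q)/I_n(p,q)$. $\underline{\mathrm{Bialg}}$: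 prop over $\mathbb{K}$ with generators $m,\Delta,\eta,\epsilon$ of bidegrees $(2,1),(1,2),(0,1),(1,0)$ and the bialgebra relations: $m$ associative with unit $\eta$, $\Delta$ coassociative with counit $\epsilon$, $\Delta\circ m=(m\otimes m)\circ(1324)\circ(\Delta\otimes\Delta)$, $\Delta\circ\eta=\eta\otimes\eta$, $\epsilon\circ m=\epsilon\otimes\epsilon$, $\epsilon\circ\eta=1$. $\underline{\mathrm{Bialg}}_{\mathrm{coco}}$ is its quotient by $\Delta=(21)\circ\Delta$. $\underline{\mathrm{Bialg}}_{\mathrm{coco},\mathrm{qt}}=\underline{\mathrm{Bialg}}_{\mathrm{coco}}\langle r\rangle/(\text{relations})$, $r$ of bidegree $(0,2)$, with relations $(\Delta\otimes\mathrm{id})\circ r=r^{1,3}\eta^2+\eta^1r^{2,3}$, $(\mathrm{id}\otimes\Delta)\circ r=r^{1,3}\eta^2+r^{1,2}\eta^3$, $(m\otimes m)\circ(1324)\circ(t\otimes\Delta)=(m\otimes m)\circ(1324)\circ(\Delta\otimes t)$ where $t=r+(21)\circ r$, and the classical Yang–Baxter relation $(\mu\otimes\mathrm{id}\otimes\mathrm{id})(r^{1,3}r^{2,4})+(\mathrm{id}\otimes\mu\otimes\mathrm{id})(r^{1,2}r^{3,4})+(\mathrm{id}\otimes\mathrm{id}\otimes\mu)(r^{1,3}r^{2,4})=0$, $\mu=m-m\circ(21)$. $\underline{\mathrm{Bialg}}_{\mathrm{QT}}=\underline{\mathrm{Bialg}}\langle R,R^{-1}\rangle/(\text{relations})$,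 $R,R^{-1}$ of bidegree $(0,2)$, with relations $(\Delta\otimes\mathrm{id})\circ R=(\mathrm{id}\otimes\mathrm{id}\otimes m)(R^{1,3}R^{2,4})$, $(\mathrm{id}\otimes\Delta)\circ R=(m\otimes\mathrm{id}\otimes\mathrm{id})(R^{1,4}R^{2,3})$, $(m\otimes m)\circ(3124)\circ(\Delta\otimes R)=(m\otimes m)\circ(1324)\circ(R\otimes\Delta)$ (i.e. $\Delta^{2,1}(x)R=R\Delta(x)$), $(m\otimes m)\circ(1324)\circ(R\otimes R^{-1})=\eta^{\otimes2}$. $\underline{\mathrm{Bialg}}_{\mathrm{qcoco},\mathrm{QT}}$: quotient of $\underline{\mathrm{Bialg}}_{\mathrm{QT}}[[\hbar]]\langle\tilde\delta,\tilde R\rangle/(\Delta-(21)\circ\Delta=\hbar\tilde\delta,\ R=\eta^{\otimes2}+\hbar\tilde R)$ by its torsion ideal. Let $\Delta^{(n)}$ be the iterated coproduct of bidegree $(1,n)$. Let $I'_n$ (resp. $J'_n$) be the ideal of $\underline{\mathrm{Bialg}}_{\mathrm{coco},\mathrm{qt}}$ (resp. $\underline{\mathrm{Bialg}}_{\mathrm{qcoco},\mathrm{QT}}$) generated by all $(\mathrm{id}-\eta\circ\epsilon)^{\otimes p}\circ\Delta^{(p)}$, $p\ge n$; $\underline{\mathrm{UE}}_{\mathrm{qt}}$ (resp. $\underline{\mathrm{QUE}}_{\mathrm{QT}}$) is the completion with respect to $(I'_n)$ (resp. $(J'_n)$). $\underline{\mathrm{SC}}:\underline{\mathrm{UE}}_{\mathrm{qt}}\to\underline{\mathrm{QUE}}_{\mathrm{QT}}/(\hbar)$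 is the surjective prop morphism extending continuously $m,\Delta,\eta,\epsilon\mapsto$ their classes, $r\mapsto$ class of $\tilde R$. A quantization morphism is a prop morphism $\underline Q:\underline{\mathrm{QUE}}_{\mathrm{QT}}\to\underline{\mathrm{UE}}_{\mathrm{qt}}[[\hbar]]$ with $(\underline Q\ \mathrm{mod}\ \hbar)\circ\underline{\mathrm{SC}}=\mathrm{id}$. (Such morphisms exist by work of Etingof and Kazhdan.) *)

(* Defs.v *)
From HB Require Import structures.
From mathcomp Require Import all_boot all_algebra perm.
From mathcomp Require Import generic_quotient ring_quotient.
From mathcomp Require Import boolp.

Set Implicit Arguments.
Unset Strict Implicit.
Unset Printing Implicit Defensive.

Import GRing.Theory.
Local Open Scope ring_scope.
Local Open Scope quotient_scope.

Declare Scope prop_scope.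
Delimit Scope prop_scope with P.

(* The permutation a |-> i_a of [1, n], for s = [:: i_1; ...; i_n]; ordinals
   are 0-based.  It is the identity if s is not a permutation of [1, n]. *)
Definition oneline (n : nat) (s : seq nat) : 'S_n :=
  insubd (1%g : 'S_n) [ffun i : 'I_n => odflt i (insub (nth 0%N s i).-1)].

Lemma onelineE n s (i : 'I_n) :
  perm_eq s (iota 1 n) -> (oneline n s i).+1 = nth 0%N s i.
Proof.
move=> ps; have sz : size s = n by rewrite (perm_size ps) size_iota.
have us : uniq s by rewrite (perm_uniq ps) iota_uniq.
have nthP (j : 'I_n) : (0 < nth 0%N s j <= n)%N.
  have : nth 0%N s j \in s by rewrite mem_nth ?sz.
  by rewrite (perm_mem ps) mem_iota add1n ltnS.
set f := [ffun i : 'I_n => odflt i (insub (nth 0%N s i).-1)].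
have fE j : (f j).+1 = nth 0%N s j.
  have /andP[s0 sn] := nthP j; rewrite ffunE insubT /=; first by rewrite prednK.
  by move=> h; rewrite /= prednK.
have fi : injectiveb f.
  apply/injectiveP => j k e; apply/ord_inj/eqP.
  by rewrite -(nth_uniq 0%N _ _ us) ?sz // -!fE e.
by rewrite -fE /oneline -pvalE /insubd insubT.
Qed.

Section BlockPerm.
Variables n m : nat.

Definition bsum_fun (s : 'S_n) (t : 'S_m) (i : 'I_(n + m)) : 'I_(n + m) :=
  unsplit (match split i with inl a => inl (s a) | inr b => inr (t b) end).

Lemma bsum_inj s t : injective (bsum_fun s t).
Proof.
move=> i j /(can_inj unsplitK) e; apply: (can_inj splitK).
by case: (split i) (split j) e => [a|a] [b|b] // [] /perm_inj ->.
Qed.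

Definition bsum (s : 'S_n) (t : 'S_m) : 'S_(n + m) := perm (@bsum_inj s t).

Definition bswap_fun (i : 'I_(n + m)) : 'I_(n + m) :=
  cast_ord (addnC m n)
    (unsplit (match split i with inl a => inr a | inr b => inl b end)).

Lemma bswap_inj : injective bswap_fun.
Proof.
move=> i j /cast_ord_inj /(can_inj unsplitK) e; apply: (can_inj splitK).
by case: (split i) (split j) e => [a|a] [b|b] // [] ->.
Qed.

(* a |-> a + m on the first block, n + b |-> b on the second one *)
Definition bswap : 'S_(n + m) := perm bswap_inj.

End BlockPerm.

Definition castB (T : nat -> nat -> Type) n m n' m' (e : n = n') (e' : m = m')
  (x : T n m) : T n' m' :=
  match e in _ = a, e' in _ = b return T a b with erefl, erefl => x end.

Lemma castB_map (T T' : nat -> nat -> Type) (phi : forall n m, T n m -> T' n m)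
    n m n' m' (e : n = n') (e' : m = m') (x : T n m) :
  phi n' m' (castB e e' x) = castB e e' (phi n m x).
Proof. by case: n' / e; case: m' / e'. Qed.

(* [hom n m] is P(n,m) = Hom(O^{(x) n}, O^{(x) m}). *)
Record prop (R : comNzRingType) := MkProp {
  hom :> nat -> nat -> lmodType R;
  idp : forall n, hom n n;
  comp : forall n m p, hom m p -> hom n m -> hom n p;
  tens : forall n m n' m', hom n m -> hom n' m' -> hom (n + n') (m + m');
  sym : forall n, 'S_n -> hom n n;
  compA : forall n m p q (f : hom p q) (g : hom m p) (h : hom n m),
    comp f (comp g h) = comp (comp f g) h;
  comp1f : forall n m (f : hom n m), comp (idp m) f = f;
  compf1 : forall n m (f : hom n m), comp f (idp n) = f;
  comp_linl : forall n m p (a : R) (f g : hom m p) (h : hom n m),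
    comp (a *: f + g) h = a *: comp f h + comp g h;
  comp_linr : forall n m p (a : R) (f : hom m p) (g h : hom n m),
    comp f (a *: g + h) = a *: comp f g + comp f h;
  tensA : forall n m n' m' n'' m''
    (f : hom n m) (g : hom n' m') (h : hom n'' m''),
    tens (tens f g) h =
    castB (T := hom) (addnA n n' n'') (addnA m m' m'') (tens f (tens g h));
  tens0f : forall n m (f : hom n m), tens (idp 0) f = f;
  tensf0 : forall n m (f : hom n m),
    tens f (idp 0) = castB (T := hom) (esym (addn0 n)) (esym (addn0 m)) f;
  tens_linl : forall n m n' m' (a : R) (f g : hom n m) (h : hom n' m'),
    tens (a *: f + g) h = a *: tens f h + tens g h;
  tens_linr : forall n m n' m' (a : R) (f : hom n m) (g h : hom n' m'),
    tens f (a *: g + h) = a *: tens f g + tens f h;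
  tens_id : forall n m, tens (idp n) (idp m) = idp (n + m);
  tens_comp : forall n m p n' m' p'
    (f : hom m p) (g : hom n m) (f' : hom m' p') (g' : hom n' m'),
    tens (comp f g) (comp f' g') = comp (tens f f') (tens g g');
  sym1 : forall n, sym (1%g : 'S_n) = idp n;
  (* permutations compose from left to right in MathComp *)
  symM : forall n (s t : 'S_n), sym (s * t)%g = comp (sym t) (sym s);
  sym_tens : forall n m (s : 'S_n) (t : 'S_m),
    tens (sym s) (sym t) = sym (bsum s t);
  sym_nat : forall n m n' m' (f : hom n m) (g : hom n' m'),
    comp (castB (T := hom) erefl (addnC m m') (sym (bswap m m'))) (tens f g) =
    comp (tens g f) (castB (T := hom) erefl (addnC n n') (sym (bswap n n')))
}.

Arguments idp {R p0} n.
Arguments comp {R p0 n m p}.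
Arguments tens {R p0 n m n' m'}.
Arguments sym {R p0 n}.

Notation "f \co g" := (comp f g) (at level 45, left associativity) : prop_scope.
Notation "f \ox g" := (tens f g) (at level 40, left associativity) : prop_scope.
Local Open Scope prop_scope.

Section PropTheory.
Variables (R : comNzRingType) (P : prop R).

Lemma compDl n m p (f g : P m p) (h : P n m) :
  (f + g) \co h = f \co h + g \co h.
Proof. by rewrite -[f]scale1r comp_linl !scale1r. Qed.
Lemma compDr n m p (f : P m p) (g h : P n m) :
  f \co (g + h) = f \co g + f \co h.
Proof. by rewrite -[g]scale1r comp_linr !scale1r. Qed.
Lemma tensDl n m p q (f g : P n m) (h : P p q) :
  (f + g) \ox h = f \ox h + g \ox h.
Proof. by rewrite -[f]scale1r tens_linl !scale1r. Qed.
Lemma tensDr n m p q (f : P n m) (g h : P p q) :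
  f \ox (g + h) = f \ox g + f \ox h.
Proof. by rewrite -[g]scale1r tens_linr !scale1r. Qed.
Lemma comp0l n m p (h : P n m) : (0 : P m p) \co h = 0.
Proof. by apply: (addrI (0 \co h)); rewrite -compDl !addr0. Qed.
Lemma comp0r n m p (h : P m p) : h \co (0 : P n m) = 0.
Proof. by apply: (addrI (h \co 0)); rewrite -compDr !addr0. Qed.
Lemma tens0l n m p q (h : P p q) : (0 : P n m) \ox h = 0.
Proof. by apply: (addrI (0 \ox h)); rewrite -tensDl !addr0. Qed.
Lemma tens0r n m p q (h : P p q) : h \ox (0 : P n m) = 0.
Proof. by apply: (addrI (h \ox 0)); rewrite -tensDr !addr0. Qed.
Lemma compZl n m p a (f : P m p) (h : P n m) : (a *: f) \co h = a *: (f \co h).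
Proof. by have := comp_linl a f 0 h; rewrite comp0l !addr0. Qed.
Lemma compZr n m p a (f : P m p) (h : P n m) : f \co (a *: h) = a *: (f \co h).
Proof. by have := comp_linr a f h 0; rewrite comp0r !addr0. Qed.
Lemma tensZl n m p q a (f : P n m) (h : P p q) :
  (a *: f) \ox h = a *: (f \ox h).
Proof. by have := tens_linl a f 0 h; rewrite tens0l !addr0. Qed.
Lemma tensZr n m p q a (f : P n m) (h : P p q) :
  f \ox (a *: h) = a *: (f \ox h).
Proof. by have := tens_linr a f h 0; rewrite tens0r !addr0. Qed.
Lemma compNl n m p (f : P m p) (h : P n m) : (- f) \co h = - (f \co h).
Proof. by rewrite -scaleN1r compZl scaleN1r. Qed.
Lemma compNr n m p (f : P m p) (h : P n m) : f \co (- h) = - (f \co h).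
Proof. by rewrite -scaleN1r compZr scaleN1r. Qed.
Lemma tensNl n m p q (f : P n m) (h : P p q) : (- f) \ox h = - (f \ox h).
Proof. by rewrite -scaleN1r tensZl scaleN1r. Qed.
Lemma tensNr n m p q (f : P n m) (h : P p q) : f \ox (- h) = - (f \ox h).
Proof. by rewrite -scaleN1r tensZr scaleN1r. Qed.
Lemma comp_suml n m p I r (Q : pred I) (F : I -> P m p) (h : P n m) :
  (\sum_(i <- r | Q i) F i) \co h = \sum_(i <- r | Q i) (F i \co h).
Proof.
by apply: (big_morph (fun f : P m p => f \co h)) => [f g|];
   rewrite ?compDl ?comp0l.
Qed.
Lemma comp_sumr n m p I r (Q : pred I) (F : I -> P n m) (h : P m p) :
  h \co (\sum_(i <- r | Q i) F i) = \sum_(i <- r | Q i) (h \co F i).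
Proof.
by apply: (big_morph (fun f : P n m => h \co f)) => [f g|];
   rewrite ?compDr ?comp0r.
Qed.
Lemma tens_suml n m p q I r (Q : pred I) (F : I -> P n m) (h : P p q) :
  (\sum_(i <- r | Q i) F i) \ox h = \sum_(i <- r | Q i) (F i \ox h).
Proof.
by apply: (big_morph (fun f : P n m => f \ox h)) => [f g|];
   rewrite ?tensDl ?tens0l.
Qed.
Lemma tens_sumr n m p q I r (Q : pred I) (F : I -> P n m) (h : P p q) :
  h \ox (\sum_(i <- r | Q i) F i) = \sum_(i <- r | Q i) (h \ox F i).
Proof.
by apply: (big_morph (fun f : P n m => h \ox f)) => [f g|];
   rewrite ?tensDr ?tens0r.
Qed.

End PropTheory.

(* Continuity for the hbar-adic topologies is automatic by linearity when
   R = K[[hbar]]. *)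
Record prop_mor (R : comNzRingType) (P Q : prop R) := PropMor {
  mfun :> forall n m, {linear P n m -> Q n m};
  mor_id : forall n, mfun n n (idp n) = idp n;
  mor_comp : forall n m p (f : P m p) (g : P n m),
    mfun n p (f \co g) = mfun m p f \co mfun n m g;
  mor_tens : forall n m n' m' (f : P n m) (g : P n' m'),
    mfun (n + n')%N (m + m')%N (f \ox g) = mfun n m f \ox mfun n' m' g;
  mor_sym : forall n (s : 'S_n), mfun n n (sym s) = sym s
}.

Definition prop_iso (R : comNzRingType) (P Q : prop R) (F : prop_mor P Q) :=
  exists G : prop_mor Q P,
    (forall n m (x : P n m), G n m (F n m x) = x) /\
    (forall n m (y : Q n m), F n m (G n m y) = y).

Record ideal (R : comNzRingType) (P : prop R) := MkIdeal {
  imem :> forall n m, P n m -> Prop;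
  ideal0 : forall n m, imem (0 : P n m);
  ideal_lin : forall n m a (x y : P n m), imem x -> imem y -> imem (a *: x + y);
  ideal_compl : forall n m p (f : P m p) (x : P n m), imem x -> imem (f \co x);
  ideal_compr : forall n m p (x : P m p) (f : P n m), imem x -> imem (x \co f);
  ideal_tensl : forall n m n' m' (f : P n m) (x : P n' m'),
    imem x -> imem (f \ox x);
  ideal_tensr : forall n m n' m' (x : P n m) (f : P n' m'),
    imem x -> imem (x \ox f)
}.

Lemma idealD R (P : prop R) (I : ideal P) n m (x y : P n m) :
  I n m x -> I n m y -> I n m (x + y).
Proof. by move=> Ix Iy; rewrite -[x]scale1r; apply: ideal_lin. Qed.

Lemma idealZ R (P : prop R) (I : ideal P) n m a (x : P n m) :
  I n m x -> I n m (a *: x).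
Proof.
by move=> Ix; rewrite -[_ *: _]addr0; apply: ideal_lin => //; apply: ideal0.
Qed.

Lemma idealB R (P : prop R) (I : ideal P) n m (x y : P n m) :
  I n m x -> I n m y -> I n m (x - y).
Proof. by move=> Ix Iy; rewrite addrC -scaleN1r; apply: ideal_lin. Qed.

Section GeneratedIdeal.
Variables (R : comNzRingType) (P : prop R) (S : forall n m, P n m -> Prop).

Inductive gen_mem : forall n m, P n m -> Prop :=
| Gen_in n m (x : P n m) : S x -> gen_mem x
| Gen_0 n m : gen_mem (0 : P n m)
| Gen_lin n m a (x y : P n m) : gen_mem x -> gen_mem y -> gen_mem (a *: x + y)
| Gen_compl n m p (f : P m p) (x : P n m) : gen_mem x -> gen_mem (f \co x)
| Gen_compr n m p (x : P m p) (f : P n m) : gen_mem x -> gen_mem (x \co f)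
| Gen_tensl n m n' m' (f : P n m) (x : P n' m') :
    gen_mem x -> gen_mem (f \ox x)
| Gen_tensr n m n' m' (x : P n m) (f : P n' m') :
    gen_mem x -> gen_mem (x \ox f).

Definition ideal_gen : ideal P :=
  MkIdeal Gen_0 Gen_lin Gen_compl Gen_compr Gen_tensl Gen_tensr.

End GeneratedIdeal.

Lemma ideal_genS R (P : prop R) (S T : forall n m, P n m -> Prop) :
  (forall n m (x : P n m), S n m x -> T n m x) ->
  forall n m (x : P n m), ideal_gen S n m x -> ideal_gen T n m x.
Proof.
move=> ST n m x; elim=> {n m x}.
- by move=> n m x /ST Tx; apply: Gen_in.
- by move=> n m; apply: Gen_0.
- by move=> n m a x y _ Tx _ Ty; apply: Gen_lin.
- by move=> n m p f x _ Tx; apply: Gen_compl.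
- by move=> n m p x f _ Tx; apply: Gen_compr.
- by move=> n m n' m' f x _ Tx; apply: Gen_tensl.
- by move=> n m n' m' x f _ Tx; apply: Gen_tensr.
Qed.

Section QuotientModule.
Variables (R : comNzRingType) (P : prop R) (I : ideal P) (n m : nat).

Definition ipred (x : P n m) : bool := `[< I n m x >].

Lemma ipred_zmod : zmod_closed ipred.
Proof.
split; first by apply/asboolP; apply: ideal0.
by move=> x y /asboolP Ix /asboolP Iy; apply/asboolP; apply: idealB.
Qed.

HB.instance Definition _ :=
  GRing.isZmodClosed.Build (P n m) ipred ipred_zmod.

Definition quotI := Quotient.quot (GRing.ZmodClosed.clone _ ipred _).
Definition qhom : Type := quotI.

HB.instance Definition _ := GRing.Zmodule.on qhom.

Definition pi (x : P n m) : qhom := \pi_quotI x.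
Definition qrepr (x : qhom) : P n m := repr (x : quotI).

Lemma qreprK x : pi (qrepr x) = x.
Proof. exact: reprK. Qed.

Lemma piP x y : pi x = pi y <-> I n m (x - y).
Proof.
split; first by move/eqP; rewrite -Quotient.idealrBE => /asboolP.
by move=> h; apply/eqP; rewrite -Quotient.idealrBE; apply/asboolP.
Qed.

Lemma piD x y : pi (x + y) = pi x + pi y.
Proof. by rewrite /pi !piE. Qed.

Lemma pi_repr x : I n m (qrepr (pi x) - x).
Proof. by apply/piP; rewrite qreprK. Qed.

Definition qscale (a : R) (x : qhom) : qhom := pi (a *: qrepr x).

Lemma pi_qscale a x : qscale a (pi x) = pi (a *: x).
Proof. by apply/piP; rewrite -scalerBr; apply/idealZ/pi_repr. Qed.

Lemma qscaleA a b v : qscale a (qscale b v) = qscale (a * b) v.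
Proof. by rewrite -[v]qreprK !pi_qscale scalerA. Qed.
Lemma qscale1 : left_id 1 qscale.
Proof. by move=> v; rewrite -[v]qreprK pi_qscale scale1r. Qed.
Lemma qscaleDr : right_distributive qscale +%R.
Proof.
move=> a v w; rewrite -[v]qreprK -[w]qreprK -piD !pi_qscale -piD.
by rewrite scalerDr.
Qed.
Lemma qscaleDl v : {morph qscale^~ v : a b / a + b}.
Proof. by move=> a b; rewrite -[v]qreprK !pi_qscale -piD scalerDl. Qed.

HB.instance Definition _ :=
  GRing.Zmodule_isLmodule.Build R qhom qscaleA qscale1 qscaleDr qscaleDl.

Lemma pi_is_linear : linear pi.
Proof. by move=> a x y; rewrite piD -pi_qscale. Qed.

HB.instance Definition _ :=
  GRing.isLinear.Build R (P n m) qhom _ pi pi_is_linear.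

End QuotientModule.

Section QuotientProp.
Variables (R : comNzRingType) (P : prop R) (I : ideal P).

Definition qcomp n m p (x : qhom I m p) (y : qhom I n m) : qhom I n p :=
  pi I (qrepr x \co qrepr y).
Definition qtens n m n' m' (x : qhom I n m) (y : qhom I n' m') :
  qhom I (n + n') (m + m') := pi I (qrepr x \ox qrepr y).

Lemma pi_comp n m p (x : P m p) (y : P n m) :
  qcomp (pi I x) (pi I y) = pi I (x \co y).
Proof.
apply/piP; set x' := qrepr _; set y' := qrepr _.
have -> : x' \co y' - x \co y = x' \co (y' - y) + (x' - x) \co y.
  by rewrite compDr compDl compNr compNl addrA subrK.
by apply: idealD; [apply: ideal_compl | apply: ideal_compr]; apply: pi_repr.
Qed.

Lemma pi_tens n m n' m' (x : P n m) (y : P n' m') :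
  qtens (pi I x) (pi I y) = pi I (x \ox y).
Proof.
apply/piP; set x' := qrepr _; set y' := qrepr _.
have -> : x' \ox y' - x \ox y = x' \ox (y' - y) + (x' - x) \ox y.
  by rewrite tensDr tensDl tensNr tensNl addrA subrK.
by apply: idealD; [apply: ideal_tensl | apply: ideal_tensr]; apply: pi_repr.
Qed.

Let piC n m n' m' (e : n = n') (e' : m = m') (x : P n m) :
  pi I (castB (T := fun n m => P n m) e e' x) =
  castB (T := qhom I) e e' (pi I x).
Proof. by case: _ / e; case: _ / e'. Qed.

Let lift := (pi_comp, pi_tens).

Definition quot_prop : prop R.
Proof.
refine (@MkProp R (fun n m => qhom I n m : lmodType R)
  (fun n => pi I (idp n)) qcomp qtens (fun n s => pi I (sym s))
  _ _ _ _ _ _ _ _ _ _ _ _ _ _ _ _).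
- move=> n m p q f g h; rewrite -[f]qreprK -[g]qreprK -[h]qreprK !lift.
  by rewrite compA.
- by move=> n m f; rewrite -[f]qreprK !lift comp1f.
- by move=> n m f; rewrite -[f]qreprK !lift compf1.
- move=> n m p a f g h; rewrite -[f]qreprK -[g]qreprK -[h]qreprK.
  by rewrite -linearP !lift comp_linl linearP.
- move=> n m p a f g h; rewrite -[f]qreprK -[g]qreprK -[h]qreprK.
  by rewrite -linearP !lift comp_linr linearP.
- move=> n m n' m' n'' m'' f g h; rewrite -[f]qreprK -[g]qreprK -[h]qreprK.
  by rewrite !lift tensA piC.
- by move=> n m f; rewrite -[f]qreprK !lift tens0f.
- by move=> n m f; rewrite -[f]qreprK !lift tensf0 piC.
- move=> n m n' m' a f g h; rewrite -[f]qreprK -[g]qreprK -[h]qreprK.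
  by rewrite -linearP !lift tens_linl linearP.
- move=> n m n' m' a f g h; rewrite -[f]qreprK -[g]qreprK -[h]qreprK.
  by rewrite -linearP !lift tens_linr linearP.
- by move=> n m; rewrite !lift tens_id.
- move=> n m p n' m' p' f g f' g'.
  rewrite -[f]qreprK -[g]qreprK -[f']qreprK -[g']qreprK !lift.
  by rewrite tens_comp.
- by move=> n; rewrite sym1.
- by move=> n s t; rewrite symM lift.
- by move=> n m s t; rewrite lift sym_tens.
- move=> n m n' m' f g; rewrite -[f]qreprK -[g]qreprK -!piC !lift.
  by rewrite sym_nat.
Defined.

Lemma pi_mor_comp n m p (x : P m p) (y : P n m) :
  pi I (x \co y) = (pi I x : quot_prop m p) \co (pi I y : quot_prop n m).
Proof. by rewrite /= pi_comp. Qed.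

Lemma pi_mor_tens n m n' m' (x : P n m) (y : P n' m') :
  pi I (x \ox y) = (pi I x : quot_prop n m) \ox (pi I y : quot_prop n' m').
Proof. by rewrite /= pi_tens. Qed.

Definition cls : prop_mor P quot_prop :=
  @PropMor R P quot_prop 
    (fun n m => @pi R P I n m : {linear P n m -> qhom I n m})
    (fun=> erefl) pi_mor_comp pi_mor_tens (fun _ _ => erefl).

End QuotientProp.

Arguments cls {R P} I.
Section FreeProp.
Variables (R : comNzRingType) (G : nat -> nat -> Type).

Inductive term : nat -> nat -> Type :=
| TGen n m : G n m -> term n m
| TId n : term n n
| TSym n : 'S_n -> term n n
| TComp n m p : term m p -> term n m -> term n p
| TTens n m n' m' : term n m -> term n' m' -> term (n + n') (m + m')
| TZero n m : term n m
| TOpp n m : term n m -> term n m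
| TAdd n m : term n m -> term n m -> term n m
| TScale n m : R -> term n m -> term n m.

Arguments TZero {n m}.

(* The least congruence containing the module and prop axioms. *)
Inductive teq : forall n m, term n m -> term n m -> Prop :=
| teq_refl n m (x : term n m) : teq x x
| teq_sym n m (x y : term n m) : teq x y -> teq y x
| teq_trans n m (x y z : term n m) : teq x y -> teq y z -> teq x z
| teq_comp n m p (x x' : term m p) (y y' : term n m) :
    teq x x' -> teq y y' -> teq (TComp x y) (TComp x' y')
| teq_tens n m n' m' (x x' : term n m) (y y' : term n' m') :
    teq x x' -> teq y y' -> teq (TTens x y) (TTens x' y')
| teq_opp n m (x x' : term n m) : teq x x' -> teq (TOpp x) (TOpp x')
| teq_add n m (x x' y y' : term n m) :
    teq x x' -> teq y y' -> teq (TAdd x y) (TAdd x' y')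
| teq_scale n m a (x x' : term n m) :
    teq x x' -> teq (TScale a x) (TScale a x')
| teq_addA n m (x y z : term n m) :
    teq (TAdd x (TAdd y z)) (TAdd (TAdd x y) z)
| teq_addC n m (x y : term n m) : teq (TAdd x y) (TAdd y x)
| teq_add0 n m (x : term n m) : teq (TAdd TZero x) x
| teq_addN n m (x : term n m) : teq (TAdd (TOpp x) x) TZero
| teq_scaleA n m a b (x : term n m) :
    teq (TScale a (TScale b x)) (TScale (a * b) x)
| teq_scale1 n m (x : term n m) : teq (TScale 1 x) x
| teq_scaleDr n m a (x y : term n m) :
    teq (TScale a (TAdd x y)) (TAdd (TScale a x) (TScale a y))
| teq_scaleDl n m a b (x : term n m) :
    teq (TScale (a + b) x) (TAdd (TScale a x) (TScale b x))
| teq_compA n m p q (f : term p q) (g : term m p) (h : term n m) :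
    teq (TComp f (TComp g h)) (TComp (TComp f g) h)
| teq_comp1f n m (f : term n m) : teq (TComp (TId m) f) f
| teq_compf1 n m (f : term n m) : teq (TComp f (TId n)) f
| teq_comp_linl n m p a (f g : term m p) (h : term n m) :
    teq (TComp (TAdd (TScale a f) g) h)
        (TAdd (TScale a (TComp f h)) (TComp g h))
| teq_comp_linr n m p a (f : term m p) (g h : term n m) :
    teq (TComp f (TAdd (TScale a g) h))
        (TAdd (TScale a (TComp f g)) (TComp f h))
| teq_tensA n m n' m' n'' m''
    (f : term n m) (g : term n' m') (h : term n'' m'') :
    teq (TTens (TTens f g) h)
        (castB (addnA n n' n'') (addnA m m' m'') (TTens f (TTens g h)))
| teq_tens0f n m (f : term n m) : teq (TTens (TId 0) f) f
| teq_tensf0 n m (f : term n m) :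
    teq (TTens f (TId 0)) (castB (esym (addn0 n)) (esym (addn0 m)) f)
| teq_tens_linl n m n' m' a (f g : term n m) (h : term n' m') :
    teq (TTens (TAdd (TScale a f) g) h)
        (TAdd (TScale a (TTens f h)) (TTens g h))
| teq_tens_linr n m n' m' a (f : term n m) (g h : term n' m') :
    teq (TTens f (TAdd (TScale a g) h))
        (TAdd (TScale a (TTens f g)) (TTens f h))
| teq_tens_id n m : teq (TTens (TId n) (TId m)) (TId (n + m))
| teq_tens_comp n m p n' m' p'
    (f : term m p) (g : term n m) (f' : term m' p') (g' : term n' m') :
    teq (TTens (TComp f g) (TComp f' g')) (TComp (TTens f f') (TTens g g'))
| teq_sym1 n : teq (TSym (1%g : 'S_n)) (TId n)
| teq_symM n (s t : 'S_n) : teq (TSym (s * t)%g) (TComp (TSym t) (TSym s))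
| teq_sym_tens n m (s : 'S_n) (t : 'S_m) :
    teq (TTens (TSym s) (TSym t)) (TSym (bsum s t))
| teq_sym_nat n m n' m' (f : term n m) (g : term n' m') :
    teq (TComp (castB (T := term) erefl (addnC m m') (TSym (bswap m m')))
               (TTens f g))
        (TComp (TTens g f)
               (castB (T := term) erefl (addnC n n') (TSym (bswap n n')))).

Section Hom.
Variables n m : nat.

HB.instance Definition _ := gen_eqMixin (term n m).
HB.instance Definition _ := gen_choiceMixin (term n m).

Definition teqb (x y : term n m) : bool := `[< teq x y >].

Lemma teqb_equiv : equiv_class_of teqb.
Proof.
split=> [x|x y|y x z]; first by apply/asboolP; apply: teq_refl.
- by apply/asboolP/asboolP; apply: teq_sym.
- by move=> /asboolP xy /asboolP yz; apply/asboolP; apply: teq_trans yz.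
Qed.

Canonical teqb_equivRel := EquivRelPack teqb_equiv.
Canonical teqb_encModRel := defaultEncModRel teqb.

Definition fquot := {eq_quot teqb}.
Definition fhom : Type := fquot.

HB.instance Definition _ := Choice.on fhom.

Definition fpi (x : term n m) : fhom := \pi_fquot x.
Definition frepr (x : fhom) : term n m := repr (x : fquot).

Lemma freprK x : fpi (frepr x) = x.
Proof. exact: reprK. Qed.

Lemma fpiP x y : fpi x = fpi y <-> teq x y.
Proof.
split; first by move/eqP; rewrite piE => /asboolP.
by move=> h; apply/eqP; rewrite piE; apply/asboolP.
Qed.

Lemma fpi_repr x : teq (frepr (fpi x)) x.
Proof. by apply/fpiP; rewrite freprK. Qed.

Definition fadd (x y : fhom) : fhom := fpi (TAdd (frepr x) (frepr y)).
Definition fopp (x : fhom) : fhom := fpi (TOpp (frepr x)).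
Definition fscale a (x : fhom) : fhom := fpi (TScale a (frepr x)).

Lemma fpi_add x y : fadd (fpi x) (fpi y) = fpi (TAdd x y).
Proof. by apply/fpiP/teq_add; apply: fpi_repr. Qed.
Lemma fpi_opp x : fopp (fpi x) = fpi (TOpp x).
Proof. by apply/fpiP/teq_opp/fpi_repr. Qed.
Lemma fpi_scale a x : fscale a (fpi x) = fpi (TScale a x).
Proof. by apply/fpiP/teq_scale/fpi_repr. Qed.

Let lift := (fpi_add, fpi_opp, fpi_scale).

Lemma faddA : associative fadd.
Proof.
move=> x y z; rewrite -[x]freprK -[y]freprK -[z]freprK !lift.
exact/fpiP/teq_addA.
Qed.
Lemma faddC : commutative fadd.
Proof.
by move=> x y; rewrite -[x]freprK -[y]freprK !lift; apply/fpiP/teq_addC.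
Qed.
Lemma fadd0 : left_id (fpi TZero) fadd.
Proof. by move=> x; rewrite -[x]freprK !lift; apply/fpiP/teq_add0. Qed.
Lemma faddN : left_inverse (fpi TZero) fopp fadd.
Proof. by move=> x; rewrite -[x]freprK !lift; apply/fpiP/teq_addN. Qed.

HB.instance Definition _ := GRing.isZmodule.Build fhom faddA faddC fadd0 faddN.

Lemma fscaleA a b v : fscale a (fscale b v) = fscale (a * b) v.
Proof. by rewrite -[v]freprK !lift; apply/fpiP/teq_scaleA. Qed.
Lemma fscale1 : left_id 1 fscale.
Proof. by move=> v; rewrite -[v]freprK !lift; apply/fpiP/teq_scale1. Qed.
Lemma fscaleDr : right_distributive fscale +%R.
Proof.
move=> a v w; rewrite -[v]freprK -[w]freprK /GRing.add /= !lift.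
exact/fpiP/teq_scaleDr.
Qed.
Lemma fscaleDl v : {morph fscale^~ v : a b / a + b}.
Proof.
move=> a b; rewrite -[v]freprK {2}/GRing.add /= !lift.
exact/fpiP/teq_scaleDl.
Qed.

HB.instance Definition _ :=
  GRing.Zmodule_isLmodule.Build R fhom fscaleA fscale1 fscaleDr fscaleDl.

Lemma fpi_lin a x y : a *: fpi x + fpi y = fpi (TAdd (TScale a x) y).
Proof. by rewrite /GRing.scale /GRing.add /= !lift. Qed.

End Hom.

Definition fcomp n m p (x : fhom m p) (y : fhom n m) : fhom n p :=
  fpi (TComp (frepr x) (frepr y)).
Definition ftens n m n' m' (x : fhom n m) (y : fhom n' m') :
  fhom (n + n') (m + m') := fpi (TTens (frepr x) (frepr y)).

Lemma fpi_comp n m p (x : term m p) (y : term n m) :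
  fcomp (fpi x) (fpi y) = fpi (TComp x y).
Proof. by apply/fpiP/teq_comp; apply: fpi_repr. Qed.
Lemma fpi_tens n m n' m' (x : term n m) (y : term n' m') :
  ftens (fpi x) (fpi y) = fpi (TTens x y).
Proof. by apply/fpiP/teq_tens; apply: fpi_repr. Qed.

Let fpiC n m n' m' (e : n = n') (e' : m = m') (x : term n m) :
  castB (T := fhom) e e' (fpi x) = fpi (castB (T := term) e e' x).
Proof. by case: _ / e; case: _ / e'. Qed.

Let lift := (fpi_comp, fpi_tens, fpiC).

Definition free_prop : prop R.
Proof.
refine (@MkProp R (fun n m => fhom n m : lmodType R)
  (fun n => fpi (TId n)) fcomp ftens (fun n s => fpi (TSym s))
  _ _ _ _ _ _ _ _ _ _ _ _ _ _ _ _).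
- move=> n m p q f g h; rewrite -[f]freprK -[g]freprK -[h]freprK !lift.
  exact/fpiP/teq_compA.
- by move=> n m f; rewrite -[f]freprK !lift; apply/fpiP/teq_comp1f.
- by move=> n m f; rewrite -[f]freprK !lift; apply/fpiP/teq_compf1.
- move=> n m p a f g h; rewrite -[f]freprK -[g]freprK -[h]freprK.
  rewrite fpi_lin !fpi_comp fpi_lin.
  exact/fpiP/teq_comp_linl.
- move=> n m p a f g h; rewrite -[f]freprK -[g]freprK -[h]freprK.
  rewrite fpi_lin !fpi_comp fpi_lin.
  exact/fpiP/teq_comp_linr.
- move=> n m n' m' n'' m'' f g h.
  rewrite -[f]freprK -[g]freprK -[h]freprK !lift.
  exact/fpiP/teq_tensA.
- by move=> n m f; rewrite -[f]freprK !lift; apply/fpiP/teq_tens0f.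
- by move=> n m f; rewrite -[f]freprK !lift; apply/fpiP/teq_tensf0.
- move=> n m n' m' a f g h; rewrite -[f]freprK -[g]freprK -[h]freprK.
  rewrite fpi_lin !fpi_tens fpi_lin.
  exact/fpiP/teq_tens_linl.
- move=> n m n' m' a f g h; rewrite -[f]freprK -[g]freprK -[h]freprK.
  rewrite fpi_lin !fpi_tens fpi_lin.
  exact/fpiP/teq_tens_linr.
- by move=> n m; rewrite !lift; apply/fpiP/teq_tens_id.
- move=> n m p n' m' p' f g f' g'.
  rewrite -[f]freprK -[g]freprK -[f']freprK -[g']freprK !lift.
  exact/fpiP/teq_tens_comp.
- by move=> n; apply/fpiP/teq_sym1.
- by move=> n s t; rewrite lift; apply/fpiP/teq_symM.
- by move=> n m s t; rewrite lift; apply/fpiP/teq_sym_tens.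
- move=> n m n' m' f g; rewrite -[f]freprK -[g]freprK !lift.
  exact/fpiP/teq_sym_nat.
Defined.

Definition fgen n m (g : G n m) : free_prop n m := fpi (TGen g).

End FreeProp.

Section Adjoin.
Variables (R : comNzRingType) (P : prop R) (G : nat -> nat -> Type).

Let F : prop R := free_prop R (fun n m => (P n m + G n m)%type).
Let jP n m (x : P n m) : F n m := fgen R (inl x).

Inductive adj_rel : forall n m, F n m -> Prop :=
| Adj_lin n m a (x y : P n m) : adj_rel (jP (a *: x + y) - (a *: jP x + jP y))
| Adj_id n : adj_rel (jP (idp n) - idp n)
| Adj_sym n (s : 'S_n) : adj_rel (jP (sym s) - sym s)
| Adj_comp n m p (x : P m p) (y : P n m) :
    adj_rel (jP (x \co y) - jP x \co jP y)
| Adj_tens n m n' m' (x : P n m) (y : P n' m') :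
    adj_rel (jP (x \ox y) - jP x \ox jP y).

(* P<G>, with no completion *)
Definition adjoin : prop R := quot_prop (ideal_gen adj_rel).

Definition adj_base n m (x : P n m) : adjoin n m :=
  cls (ideal_gen adj_rel) n m (jP x).
Definition adj_gen n m (g : G n m) : adjoin n m :=
  cls (ideal_gen adj_rel) n m (fgen R (inr g)).

End Adjoin.
Record filtration (R : comNzRingType) (P : prop R) := MkFiltration {
  fil :> nat -> ideal P;
  fil_dec : forall k n m (x : P n m), fil k.+1 n m x -> fil k n m x
}.

Section DProd.
Variables (R : comNzRingType) (V : nat -> lmodType R).

Definition dprod : Type := forall k, V k.

HB.instance Definition _ := gen_eqMixin dprod.
HB.instance Definition _ := gen_choiceMixin dprod.

Lemma dprodP (x y : dprod) : (forall k, x k = y k) -> x = y.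
Proof. exact: functional_extensionality_dep. Qed.

Definition dadd (x y : dprod) : dprod := fun k => x k + y k.
Definition dopp (x : dprod) : dprod := fun k => - x k.
Definition dzero : dprod := fun k => 0.
Definition dscale (a : R) (x : dprod) : dprod := fun k => a *: x k.

Lemma daddA : associative dadd.
Proof. by move=> x y z; apply: dprodP => k; apply: addrA. Qed.
Lemma daddC : commutative dadd.
Proof. by move=> x y; apply: dprodP => k; apply: addrC. Qed.
Lemma dadd0 : left_id dzero dadd.
Proof. by move=> x; apply: dprodP => k; apply: add0r. Qed.
Lemma daddN : left_inverse dzero dopp dadd.
Proof. by move=> x; apply: dprodP => k; apply: addNr. Qed.

HB.instance Definition _ := GRing.isZmodule.Build dprod daddA daddC dadd0 daddN.

Lemma dscaleA a b x : dscale a (dscale b x) = dscale (a * b) x.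
Proof. by apply: dprodP => k; apply: scalerA. Qed.
Lemma dscale1 : left_id 1 dscale.
Proof. by move=> x; apply: dprodP => k; apply: scale1r. Qed.
Lemma dscaleDr : right_distributive dscale +%R.
Proof. by move=> a x y; apply: dprodP => k; apply: scalerDr. Qed.
Lemma dscaleDl x : {morph dscale^~ x : a b / a + b}.
Proof. by move=> a b; apply: dprodP => k; apply: scalerDl. Qed.

HB.instance Definition _ :=
  GRing.Zmodule_isLmodule.Build R dprod dscaleA dscale1 dscaleDr dscaleDl.

End DProd.

Section Transition.
Variables (R : comNzRingType) (P : prop R) (I : filtration P).

(* the projection P/I_{k+1} -> P/I_k *)
Definition trans k n m (x : quot_prop (I k.+1) n m) : quot_prop (I k) n m :=
  cls (I k) n m (qrepr x).

Lemma trans_cls k n m (x : P n m) :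
  trans (cls (I k.+1) n m x) = cls (I k) n m x.
Proof. exact/piP/fil_dec/pi_repr. Qed.

Lemma clsE k n m (x : quot_prop (I k) n m) : x = cls (I k) n m (qrepr x).
Proof. by rewrite /= qreprK. Qed.

Lemma trans_lin k n m a (x y : quot_prop (I k.+1) n m) :
  trans (a *: x + y) = a *: trans x + trans y.
Proof. by rewrite (clsE x) (clsE y) -linearP !trans_cls linearP. Qed.

Lemma trans_comp k n m p
    (x : quot_prop (I k.+1) m p) (y : quot_prop (I k.+1) n m) :
  trans (x \co y) = trans x \co trans y.
Proof. by rewrite (clsE x) (clsE y) -mor_comp !trans_cls mor_comp. Qed.

Lemma trans_tens k n m n' m'
    (x : quot_prop (I k.+1) n m) (y : quot_prop (I k.+1) n' m') :
  trans (x \ox y) = trans x \ox trans y.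
Proof. by rewrite (clsE x) (clsE y) -mor_tens !trans_cls mor_tens. Qed.

End Transition.

Section Completion.
Variables (R : comNzRingType) (P : prop R) (I : filtration P).

Section Hom.
Variables n m : nat.

Definition compatible (x : dprod (fun k => quot_prop (I k) n m)) : bool :=
  `[< forall k, trans (x k.+1) = x k >].

(* The inverse limit of the P(n,m)/I_k(n,m). *)
Record chom := CHom { cval : dprod (fun k => quot_prop (I k) n m);
                      cvalP : compatible cval }.

(* the k-th component *)
Definition cproj (x : chom) (k : nat) : quot_prop (I k) n m := cval x k.
Coercion cproj : chom >-> Funclass.

HB.instance Definition _ := [isSub for cval].
HB.instance Definition _ := [Choice of chom by <:].

Lemma compatibleP (x : dprod (fun k => quot_prop (I k) n m)) :
  reflect (forall k, trans (x k.+1) = x k) (compatible x).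
Proof. exact: asboolP. Qed.

Lemma chomE (x : chom) k : trans (x k.+1) = x k.
Proof. by have /compatibleP := cvalP x. Qed.

Lemma chomP (x y : chom) : (forall k, x k = y k) -> x = y.
Proof. by move=> e; apply/val_inj/dprodP. Qed.

Lemma compatible_lin a x y :
  compatible x -> compatible y -> compatible (a *: x + y).
Proof.
move=> /compatibleP cx /compatibleP cy; apply/compatibleP => k.
by rewrite [LHS]trans_lin cx cy.
Qed.

Lemma compatible0 : compatible 0.
Proof.
apply/compatibleP => k; have := trans_cls I k (0 : P n m).
by rewrite !linear0.
Qed.

Definition clin a (x y : chom) := CHom (compatible_lin a (cvalP x) (cvalP y)).
Definition czero : chom := CHom compatible0.
Definition cadd x y := clin 1 x y.
Definition copp x := clin (-1) x czero.
Definition cscale a x := clin a x czero.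

Let caddE x y k : cadd x y k = x k + y k.
Proof. by change (1 *: x k + y k = x k + y k); rewrite scale1r. Qed.
Let coppE x k : copp x k = - x k.
Proof. by change (-1 *: x k + 0 = - x k); rewrite scaleN1r addr0. Qed.
Let cscaleE a x k : cscale a x k = a *: x k.
Proof. by change (a *: x k + 0 = a *: x k); rewrite addr0. Qed.

Lemma caddA : associative cadd.
Proof. by move=> x y z; apply: chomP => k; rewrite !caddE addrA. Qed.
Lemma caddC : commutative cadd.
Proof. by move=> x y; apply: chomP => k; rewrite !caddE addrC. Qed.
Lemma cadd0 : left_id czero cadd.
Proof. by move=> x; apply: chomP => k; rewrite !caddE add0r. Qed.
Lemma caddN : left_inverse czero copp cadd.
Proof. by move=> x; apply: chomP => k; rewrite !caddE coppE addNr. Qed.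

HB.instance Definition _ := GRing.isZmodule.Build chom caddA caddC cadd0 caddN.

Lemma cscaleA a b x : cscale a (cscale b x) = cscale (a * b) x.
Proof. by apply: chomP => k; rewrite !cscaleE scalerA. Qed.
Lemma cscale1 : left_id 1 cscale.
Proof. by move=> x; apply: chomP => k; rewrite !cscaleE scale1r. Qed.
Lemma cscaleDr : right_distributive cscale +%R.
Proof.
move=> a x y; apply: chomP => k.
by rewrite !(cscaleE, caddE) scalerDr.
Qed.
Lemma cscaleDl x : {morph cscale^~ x : a b / a + b}.
Proof.
move=> a b; apply: chomP => k.
by rewrite !(cscaleE, caddE) scalerDl.
Qed.

HB.instance Definition _ :=
  GRing.Zmodule_isLmodule.Build R chom cscaleA cscale1 cscaleDr cscaleDl.

Lemma chom_linE a (x y : chom) k : (a *: x + y) k = a *: x k + y k.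
Proof. by rewrite caddE cscaleE. Qed.

End Hom.

Lemma ccomp_subproof n m p (x : chom m p) (y : chom n m) :
  compatible (fun k => x k \co y k).
Proof. by apply/compatibleP => k; rewrite trans_comp !chomE. Qed.
Definition ccomp n m p (x : chom m p) (y : chom n m) : chom n p :=
  CHom (ccomp_subproof x y).

Lemma ctens_subproof n m n' m' (x : chom n m) (y : chom n' m') :
  compatible (fun k => x k \ox y k).
Proof. by apply/compatibleP => k; rewrite trans_tens !chomE. Qed.
Definition ctens n m n' m' (x : chom n m) (y : chom n' m') :
  chom (n + n') (m + m') := CHom (ctens_subproof x y).

Lemma cconst_subproof n m (x : P n m) : compatible (fun k => cls (I k) n m x).
Proof. by apply/compatibleP => k; rewrite trans_cls. Qed.
Definition cconst n m (x : P n m) : chom n m := CHom (cconst_subproof x).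

Let castE n m n' m' (e : n = n') (e' : m = m') (x : chom n m) k :
  (castB (T := chom) e e' x) k =
  castB (T := fun n m => quot_prop (I k) n m) e e' (x k).
Proof. by case: _ / e; case: _ / e'. Qed.

Definition completion : prop R.
Proof.
refine (@MkProp R (fun n m => chom n m : lmodType R)
  (fun n => cconst (idp n)) ccomp ctens (fun n s => cconst (sym s))
  _ _ _ _ _ _ _ _ _ _ _ _ _ _ _ _).
- by move=> n m p q f g h; apply: chomP => k; apply: compA.
- by move=> n m f; apply: chomP => k; apply: comp1f.
- by move=> n m f; apply: chomP => k; apply: compf1.
- move=> n m p a f g h; apply: chomP => k.
  by rewrite chom_linE -comp_linl -chom_linE.
- move=> n m p a f g h; apply: chomP => k.
  by rewrite chom_linE -comp_linr -chom_linE.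
- move=> n m n' m' n'' m'' f g h; apply: chomP => k.
  by rewrite castE; apply: tensA.
- by move=> n m f; apply: chomP => k; apply: tens0f.
- by move=> n m f; apply: chomP => k; rewrite castE; apply: tensf0.
- move=> n m n' m' a f g h; apply: chomP => k.
  by rewrite chom_linE -tens_linl -chom_linE.
- move=> n m n' m' a f g h; apply: chomP => k.
  by rewrite chom_linE -tens_linr -chom_linE.
- by move=> n m; apply: chomP => k; apply: tens_id.
- by move=> n m p n' m' p' f g f' g'; apply: chomP => k; apply: tens_comp.
- by move=> n; apply: chomP => k; apply: sym1.
- by move=> n s t; apply: chomP => k; apply: symM.
- by move=> n m s t; apply: chomP => k; apply: sym_tens.
- move=> n m n' m' f g; apply: chomP => k.
  transitivity (castB (T := chom) erefl (addnC m m')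
    (cconst (sym (bswap m m'))) k \co (f k \ox g k)) => //.
  rewrite castE [LHS]sym_nat.
  transitivity ((g k \ox f k) \co castB (T := chom) erefl (addnC n n')
    (cconst (sym (bswap n n'))) k) => //.
  by rewrite castE.
Defined.

Definition to_completion n m (x : P n m) : completion n m := cconst x.

End Completion.
Section Convolution.
Variable V : zmodType.

Definition conv (F : nat -> nat -> V) (n : nat) : V :=
  \sum_(i < n.+1) F i (n - i)%N.

Lemma eq_conv F F' n : (forall i j, F i j = F' i j) -> conv F n = conv F' n.
Proof. by move=> e; apply: eq_bigr => i _; apply: e. Qed.

Lemma conv_swap F n : conv F n = conv (fun i j => F j i) n.
Proof.
rewrite /conv (reindex_inj rev_ord_inj) /=; apply: eq_bigr => i _.
by rewrite !subSS subKn // -ltnS ltn_ord.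
Qed.

Lemma conv_assoc (F : nat -> nat -> nat -> V) n :
  conv (fun a k => conv (fun i j => F i j k) a) n =
  conv (fun i b => conv (fun j k => F i j k) b) n.
Proof.
rewrite /conv.
transitivity (\sum_(a < n.+1) \sum_(i < n.+1 | (i <= a)%N)
                F i (a - i)%N (n - a)%N).
  apply: eq_bigr => a _.
  by rewrite (big_ord_widen n.+1 (fun i => F i (a - i)%N (n - a)%N)).
rewrite (exchange_big_dep xpredT) //=; apply: eq_bigr => i _.
rewrite -(big_mkord (fun a => i <= a)%N (fun a => F i (a - i)%N (n - a)%N)).
rewrite (big_cat_nat _ (n := i)) //=; last by rewrite ltnW.
rewrite big_nat_cond big_pred0 ?add0r; last first.
  by move=> a; apply/negbTE/negP => /andP[/andP[_ h]]; rewrite leqNgt h.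
rewrite -{1}[i : nat]add0n big_addn subSn; last by rewrite -ltnS.
rewrite big_mkord; apply: eq_big => j; first by rewrite leq_addl.
by move=> _; rewrite addnK (addnC j) subnDA.
Qed.

End Convolution.

Lemma conv_morph (V W : zmodType) (f : V -> W) F n :
  f 0 = 0 -> {morph f : x y / x + y} ->
  f (conv F n) = conv (fun i j => f (F i j)) n.
Proof. by move=> f0 fD; apply: (big_morph f). Qed.

Record pseries (V : Type) := PSeries { pcoef :> nat -> V }.

Lemma pseriesP V (x y : pseries V) : (forall k, x k = y k) -> x = y.
Proof. by case: x y => [x] [y] /= e; congr PSeries; apply: funext. Qed.

HB.instance Definition _ V := gen_eqMixin (pseries V).
HB.instance Definition _ V := gen_choiceMixin (pseries V).

Section PSeriesZmod.
Variable V : zmodType.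
Implicit Types x y z : pseries V.

Definition padd x y := PSeries (fun k => x k + y k).
Definition popp x := PSeries (fun k => - x k).
Definition pconst (v : V) := PSeries (fun k => if k == 0%N then v else 0).

Lemma paddA : associative padd.
Proof. by move=> x y z; apply: pseriesP => k; apply: addrA. Qed.
Lemma paddC : commutative padd.
Proof. by move=> x y; apply: pseriesP => k; apply: addrC. Qed.
Lemma padd0 : left_id (pconst 0) padd.
Proof. by move=> x; apply: pseriesP => k /=; rewrite if_same add0r. Qed.
Lemma paddN : left_inverse (pconst 0) popp padd.
Proof. by move=> x; apply: pseriesP => k /=; rewrite if_same addNr. Qed.

HB.instance Definition _ :=
  GRing.isZmodule.Build (pseries V) paddA paddC padd0 paddN.

Lemma pcoefD x y k : (x + y) k = x k + y k. Proof. by []. Qed.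

End PSeriesZmod.

Lemma conv_constl (V W : zmodType) (v : V) (y : pseries W)
    (op : V -> W -> W) n :
  (forall w, op 0 w = 0) ->
  conv (fun i j => op (pconst v i) (y j)) n = op v (y n).
Proof.
by move=> op0; rewrite /conv big_ord_recl /= subn0 big1 ?addr0 // => i _;
   rewrite op0.
Qed.

Section PSeriesRing.
Variable R : comNzRingType.
Implicit Types x y z : pseries R.

Definition pmul x y := PSeries (conv (fun i j => x i * y j)).

Lemma pmulA : associative pmul.
Proof.
move=> x y z; apply: pseriesP => k /=.
transitivity (conv (fun i b => conv (fun j l => x i * (y j * z l)) b) k).
  apply: eq_conv => i j.
  apply: (conv_morph (f := fun u => x i * u)) => [|u v];
  by rewrite ?mulr0 ?mulrDr.
rewrite -conv_assoc; apply: eq_conv => i j.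
rewrite [RHS](conv_morph (f := fun u => u * z j)) => [|| u v];
  rewrite ?mul0r ?mulrDl //.
by apply: eq_conv => a b; rewrite mulrA.
Qed.
Lemma pmulC : commutative pmul.
Proof.
move=> x y; apply: pseriesP => k /=; rewrite conv_swap.
by apply: eq_conv => i j; rewrite mulrC.
Qed.
Lemma pmul1 : left_id (pconst (1 : R)) pmul.
Proof.
move=> x; apply: pseriesP => k /=.
by rewrite (conv_constl _ x (op := *%R)) ?mul1r // => w; rewrite mul0r.
Qed.
Lemma pmulDl : left_distributive pmul +%R.
Proof.
move=> x y z; apply: pseriesP => k; rewrite pcoefD /= /conv -big_split /=.
by apply: eq_bigr => i _; rewrite mulrDl.
Qed.
Lemma pone_neq0 : pconst (1 : R) != 0.
Proof.
by apply/eqP => /(congr1 (fun x => pcoef x 0)) /= /eqP; rewrite oner_eq0.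
Qed.

HB.instance Definition _ := GRing.Zmodule_isComNzRing.Build (pseries R)
  pmulA pmulC pmul1 pmulDl pone_neq0.

Definition hbar : pseries R := PSeries (fun k => (k == 1%N)%:R).

Lemma pmulE x y k : (x * y) k = conv (fun i j => x i * y j) k.
Proof. by []. Qed.

End PSeriesRing.

Arguments hbar {R}.

Section PSeriesModule.
Variables (R : comNzRingType) (V : lmodType R).
Implicit Types (a b : pseries R) (x y : pseries V).

Definition pscale a x := PSeries (conv (fun i j => a i *: x j)).

Lemma pscaleA a b x : pscale a (pscale b x) = pscale (a * b) x.
Proof.
apply: pseriesP => k /=.
transitivity (conv (fun i c => conv (fun j l => a i *: (b j *: x l)) c) k).
  apply: eq_conv => i j.
  apply: (conv_morph (f := fun u => a i *: u)) => [|u v];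
  by rewrite ?scaler0 ?scalerDr.
rewrite -conv_assoc; apply: eq_conv => i j.
rewrite [RHS](conv_morph (f := fun u => u *: x j)) => [|| u v];
  rewrite ?scale0r ?scalerDl //.
by apply: eq_conv => c d; rewrite scalerA.
Qed.
Lemma pscale1 : left_id 1 pscale.
Proof.
move=> x; apply: pseriesP => k /=.
by rewrite (conv_constl _ x (op := *:%R)) ?scale1r // => w; rewrite scale0r.
Qed.
Lemma pscaleDr : right_distributive pscale +%R.
Proof.
move=> a x y; apply: pseriesP => k; rewrite pcoefD /= /conv -big_split /=.
by apply: eq_bigr => i _; rewrite scalerDr.
Qed.
Lemma pscaleDl x : {morph pscale^~ x : a b / a + b}.
Proof.
move=> a b; apply: pseriesP => k; rewrite pcoefD /= /conv -big_split /=.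
by apply: eq_bigr => i _; rewrite scalerDl.
Qed.

HB.instance Definition _ := GRing.Zmodule_isLmodule.Build (pseries R)
  (pseries V) pscaleA pscale1 pscaleDr pscaleDl.

Lemma pscaleE a x k : (a *: x) k = conv (fun i j => a i *: x j) k.
Proof. by []. Qed.

End PSeriesModule.

Section PSeriesProp.
Variables (R : comNzRingType) (P : prop R).

Let H n m : lmodType (pseries R) := pseries (P n m).

Definition pcomp n m p (x : H m p) (y : H n m) : H n p :=
  PSeries (conv (fun i j => x i \co y j)).
Definition ptens n m n' m' (x : H n m) (y : H n' m') : H (n + n') (m + m') :=
  PSeries (conv (fun i j => x i \ox y j)).

Let castE n m n' m' (e : n = n') (e' : m = m') (x : H n m) k :
  pcoef (castB (T := fun n m => H n m) e e' x) k =
  castB (T := fun n m => P n m) e e' (x k).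
Proof. by case: _ / e; case: _ / e'. Qed.

Let castD n m n' m' (e : n = n') (e' : m = m') (F : nat -> nat -> P n m) k :
  castB (T := fun n m => P n m) e e' (conv F k) =
  conv (fun i j => castB (T := fun n m => P n m) e e' (F i j)) k.
Proof. by case: _ / e; case: _ / e'. Qed.

Let castK n m n' m' (e : n = n') (e' : m = m') (x : P n m) :
  castB (T := fun n m => H n m) e e' (pconst x) =
  pconst (castB (T := fun n m => P n m) e e' x).
Proof. by case: _ / e; case: _ / e'. Qed.

Lemma pcompDl n m p (x y : H m p) (z : H n m) :
  pcomp (x + y) z = pcomp x z + pcomp y z.
Proof.
apply: pseriesP => k; rewrite pcoefD /= /conv -big_split /=.
by apply: eq_bigr => i _; rewrite compDl.
Qed.
Lemma pcompDr n m p (z : H m p) (x y : H n m) :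
  pcomp z (x + y) = pcomp z x + pcomp z y.
Proof.
apply: pseriesP => k; rewrite pcoefD /= /conv -big_split /=.
by apply: eq_bigr => i _; rewrite compDr.
Qed.
Lemma pcompZl n m p a (x : H m p) (z : H n m) :
  pcomp (a *: x) z = a *: pcomp x z.
Proof.
apply: pseriesP => k; rewrite pscaleE /=.
transitivity (conv (fun c l => conv (fun i j => a i *: (x j \co z l)) c) k).
  apply: eq_conv => c l.
  rewrite (conv_morph (f := fun u => u \co z l)) => [|| u v];
    rewrite ?comp0l ?compDl //.
  by apply: eq_conv => i j; rewrite compZl.
rewrite conv_assoc; apply: eq_conv => i c.
rewrite [RHS](conv_morph (f := fun u => a i *: u)) => [||u v] //;
by rewrite ?scaler0 ?scalerDr.
Qed.
Lemma pcompZr n m p a (z : H m p) (x : H n m) :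
  pcomp z (a *: x) = a *: pcomp z x.
Proof.
apply: pseriesP => k; rewrite pscaleE /=.
transitivity (conv (fun l c => conv (fun i j => a i *: (z l \co x j)) c) k).
  apply: eq_conv => l c.
  rewrite (conv_morph (f := fun u => z l \co u)) => [|| u v];
    rewrite ?comp0r ?compDr //.
  by apply: eq_conv => i j; rewrite compZr.
rewrite -conv_assoc.
transitivity (conv (fun c j => conv (fun i l => a i *: (z l \co x j)) c) k).
  by apply: eq_conv => c j; rewrite conv_swap.
rewrite conv_assoc; apply: eq_conv => i c.
rewrite [RHS](conv_morph (f := fun u => a i *: u)) => [||u v] //;
by rewrite ?scaler0 ?scalerDr.
Qed.

Lemma ptensDl n m p q (x y : H n m) (z : H p q) :
  ptens (x + y) z = ptens x z + ptens y z.
Proof.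
apply: pseriesP => k; rewrite pcoefD /= /conv -big_split /=.
by apply: eq_bigr => i _; rewrite tensDl.
Qed.
Lemma ptensDr n m p q (z : H p q) (x y : H n m) :
  ptens z (x + y) = ptens z x + ptens z y.
Proof.
apply: pseriesP => k; rewrite pcoefD /= /conv -big_split /=.
by apply: eq_bigr => i _; rewrite tensDr.
Qed.
Lemma ptensZl n m p q a (x : H n m) (z : H p q) :
  ptens (a *: x) z = a *: ptens x z.
Proof.
apply: pseriesP => k; rewrite pscaleE /=.
transitivity (conv (fun c l => conv (fun i j => a i *: (x j \ox z l)) c) k).
  apply: eq_conv => c l.
  rewrite (conv_morph (f := fun u => u \ox z l)) => [|| u v];
    rewrite ?tens0l ?tensDl //.
  by apply: eq_conv => i j; rewrite tensZl.
rewrite conv_assoc; apply: eq_conv => i c.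
rewrite [RHS](conv_morph (f := fun u => a i *: u)) => [||u v] //;
by rewrite ?scaler0 ?scalerDr.
Qed.
Lemma ptensZr n m p q a (z : H p q) (x : H n m) :
  ptens z (a *: x) = a *: ptens z x.
Proof.
apply: pseriesP => k; rewrite pscaleE /=.
transitivity (conv (fun l c => conv (fun i j => a i *: (z l \ox x j)) c) k).
  apply: eq_conv => l c.
  rewrite (conv_morph (f := fun u => z l \ox u)) => [|| u v];
    rewrite ?tens0r ?tensDr //.
  by apply: eq_conv => i j; rewrite tensZr.
rewrite -conv_assoc.
transitivity (conv (fun c j => conv (fun i l => a i *: (z l \ox x j)) c) k).
  by apply: eq_conv => c j; rewrite conv_swap.
rewrite conv_assoc; apply: eq_conv => i c.
rewrite [RHS](conv_morph (f := fun u => a i *: u)) => [||u v] //;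
by rewrite ?scaler0 ?scalerDr.
Qed.

Lemma pcomp_constl n m p (f : P m p) (y : H n m) k :
  pcomp (pconst f) y k = f \co y k.
Proof.
by rewrite /= /conv big_ord_recl subn0 big1 ?addr0 // => i _; rewrite comp0l.
Qed.
Lemma pcomp_constr n m p (x : H m p) (f : P n m) k :
  pcomp x (pconst f) k = x k \co f.
Proof.
rewrite /= conv_swap /conv big_ord_recl subn0 big1 ?addr0 // => i _.
by rewrite comp0r.
Qed.
Lemma ptens_constl n m p q (f : P n m) (y : H p q) k :
  ptens (pconst f) y k = f \ox y k.
Proof.
by rewrite /= /conv big_ord_recl subn0 big1 ?addr0 // => i _; rewrite tens0l.
Qed.
Lemma ptens_constr n m p q (x : H n m) (f : P p q) k :
  ptens x (pconst f) k = x k \ox f.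
Proof.
rewrite /= conv_swap /conv big_ord_recl subn0 big1 ?addr0 // => i _.
by rewrite tens0r.
Qed.

Lemma pcomp_const n m p (f : P m p) (g : P n m) :
  pcomp (pconst f) (pconst g) = pconst (f \co g).
Proof.
apply: pseriesP => k; rewrite pcomp_constl /=.
by case: k => //= k; rewrite comp0r.
Qed.
Lemma ptens_const n m p q (f : P n m) (g : P p q) :
  ptens (pconst f) (pconst g) = pconst (f \ox g).
Proof.
apply: pseriesP => k; rewrite ptens_constl /=.
by case: k => //= k; rewrite tens0r.
Qed.

Definition pseries_prop : prop (pseries R).
Proof.
refine (@MkProp (pseries R) H (fun n => pconst (idp n)) pcomp ptens
  (fun n s => pconst (sym s)) _ _ _ _ _ _ _ _ _ _ _ _ _ _ _ _).
- move=> n m p q f g h; apply: pseriesP => k /=.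
  transitivity (conv (fun i b => conv (fun j l => f i \co (g j \co h l)) b) k).
    apply: eq_conv => i j; apply: (conv_morph (f := fun u => f i \co u)).
      by rewrite comp0r.
    by move=> u v; rewrite compDr.
  rewrite -conv_assoc; apply: eq_conv => i j.
  rewrite [RHS](conv_morph (f := fun u => u \co h j)) => [|| u v];
    rewrite ?comp0l ?compDl //.
  by apply: eq_conv => a b; rewrite compA.
- by move=> n m f; apply: pseriesP => k; rewrite pcomp_constl comp1f.
- by move=> n m f; apply: pseriesP => k; rewrite pcomp_constr compf1.
- by move=> n m p a f g h; rewrite pcompDl pcompZl.
- by move=> n m p a f g h; rewrite pcompDr pcompZr.
- move=> n m n' m' n'' m'' f g h; apply: pseriesP => k; rewrite castE /= castD.
  transitivity (conv (fun a l => conv (fun i j => f i \ox g j \ox h l) a) k).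
    apply: eq_conv => a l; apply: (conv_morph (f := fun u => u \ox h l)).
      by rewrite tens0l.
    by move=> u v; rewrite tensDl.
  rewrite conv_assoc; apply: eq_conv => i b.
  rewrite (conv_morph (f := fun u => f i \ox u)) => [||u v];
    rewrite ?tens0r ?tensDr // castD.
  by apply: eq_conv => j l; rewrite tensA.
- by move=> n m f; apply: pseriesP => k; rewrite ptens_constl tens0f.
- by move=> n m f; apply: pseriesP => k; rewrite ptens_constr castE tensf0.
- by move=> n m n' m' a f g h; rewrite ptensDl ptensZl.
- by move=> n m n' m' a f g h; rewrite ptensDr ptensZr.
- by move=> n m; rewrite ptens_const tens_id.
- move=> n m p n' m' p' f g f' g'; apply: pseriesP => k /=.
  transitivity (conv (fun a b => conv (fun i j => conv (fun l q =>
    (f i \ox f' l) \co (g j \ox g' q)) b) a) k).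
    apply: eq_conv => a b.
    rewrite (conv_morph (f := fun u => u \ox _)) => [||u v];
      rewrite ?tens0l ?tensDl //.
    apply: eq_conv => i j.
    rewrite (conv_morph (f := fun u => _ \ox u)) => [||u v];
      rewrite ?tens0r ?tensDr //.
    by apply: eq_conv => l q; rewrite tens_comp.
  rewrite conv_assoc.
  transitivity (conv (fun i b => conv (fun l c => conv (fun j q =>
    (f i \ox f' l) \co (g j \ox g' q)) c) b) k).
    apply: eq_conv => i b; rewrite -[LHS]conv_assoc -[RHS]conv_assoc.
    by apply: eq_conv => c q; rewrite conv_swap.
  rewrite -conv_assoc; apply: eq_conv => a c.
  rewrite [RHS](conv_morph (f := fun u => u \co _)) => [||u v];
    rewrite ?comp0l ?compDl //.
  apply: eq_conv => i j.
  rewrite [RHS](conv_morph (f := fun u => _ \co u)) => [||u v];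
    rewrite ?comp0r ?compDr //.
- by move=> n; rewrite sym1.
- by move=> n s t; rewrite pcomp_const symM.
- by move=> n m s t; rewrite ptens_const sym_tens.
- move=> n m n' m' f g; rewrite !castK; apply: pseriesP => k.
  rewrite pcomp_constl pcomp_constr /=.
  rewrite (conv_morph (f := fun u => _ \co u)) => [||u v];
    rewrite ?comp0r ?compDr //.
  rewrite [in RHS]conv_swap (conv_morph (f := fun u => u \co _)) => [||u v];
    rewrite ?comp0l ?compDl //.
  by apply: eq_conv => i j; rewrite sym_nat.
Defined.

End PSeriesProp.

Section Restriction.
Variables (R : comNzRingType).

Section Hom.
Variable V : lmodType (pseries R).

Definition rhom : Type := V.
HB.instance Definition _ := GRing.Zmodule.on rhom.

Definition rscale (a : R) (x : rhom) : rhom := pconst a *: (x : V).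

Lemma pconstM (a b : R) : pconst (a * b) = pconst a * pconst b.
Proof.
apply: pseriesP => k.
rewrite pmulE (conv_constl _ (pconst b) (op := *%R)) => [|w]; last exact: mul0r.
by case: k => //= k; rewrite mulr0.
Qed.
Lemma pconstD (a b : R) : pconst (a + b) = pconst a + pconst b.
Proof. by apply: pseriesP => -[|k] //=; rewrite addr0. Qed.

Lemma rscaleA a b x : rscale a (rscale b x) = rscale (a * b) x.
Proof. by rewrite /rscale scalerA pconstM. Qed.
Lemma rscale1 : left_id 1 rscale.
Proof. by move=> x; apply: scale1r. Qed.
Lemma rscaleDr : right_distributive rscale +%R.
Proof. by move=> a x y; apply: scalerDr. Qed.
Lemma rscaleDl x : {morph rscale^~ x : a b / a + b}.
Proof. by move=> a b; rewrite /rscale pconstD scalerDl. Qed.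

HB.instance Definition _ :=
  GRing.Zmodule_isLmodule.Build R rhom rscaleA rscale1 rscaleDr rscaleDl.

End Hom.

Variable P : prop (pseries R).

Definition restrict_prop : prop R.
Proof.
refine (@MkProp R (fun n m => rhom (P n m) : lmodType R)
  (fun n => idp n : P n n)
  (fun n m p (x : P m p) (y : P n m) => x \co y)
  (fun n m n' m' (x : P n m) (y : P n' m') => x \ox y)
  (fun n s => sym s : P n n)
  _ _ _ _ _ _ _ _ _ _ _ _ _ _ _ _).
- exact: (@compA _ P).
- exact: (@comp1f _ P).
- exact: (@compf1 _ P).
- by move=> n m p a f g h; apply: (@comp_linl _ P).
- by move=> n m p a f g h; apply: (@comp_linr _ P).
- exact: (@tensA _ P).
- exact: (@tens0f _ P).
- exact: (@tensf0 _ P).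
- by move=> n m n' m' a f g h; apply: (@tens_linl _ P).
- by move=> n m n' m' a f g h; apply: (@tens_linr _ P).
- exact: (@tens_id _ P).
- exact: (@tens_comp _ P).
- exact: (@sym1 _ P).
- exact: (@symM _ P).
- exact: (@sym_tens _ P).
- exact: (@sym_nat _ P).
Defined.

End Restriction.

Section HbarIdeals.
Variables (K : fieldType) (P : prop (pseries K)).

Section HIdeal.
Variable k : nat.

Definition h_mem n m (x : P n m) := exists y, x = hbar ^+ k *: y.

Lemma h_mem0 n m : h_mem (0 : P n m).
Proof. by exists 0; rewrite scaler0. Qed.
Lemma h_mem_lin n m a (x y : P n m) : h_mem x -> h_mem y -> h_mem (a *: x + y).
Proof.
move=> [u ->] [v ->]; exists (a *: u + v).
by rewrite scalerDr !scalerA mulrC.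
Qed.
Lemma h_mem_compl n m p (f : P m p) (x : P n m) : h_mem x -> h_mem (f \co x).
Proof. by move=> [u ->]; exists (f \co u); rewrite compZr. Qed.
Lemma h_mem_compr n m p (x : P m p) (f : P n m) : h_mem x -> h_mem (x \co f).
Proof. by move=> [u ->]; exists (u \co f); rewrite compZl. Qed.
Lemma h_mem_tensl n m n' m' (f : P n m) (x : P n' m') :
  h_mem x -> h_mem (f \ox x).
Proof. by move=> [u ->]; exists (f \ox u); rewrite tensZr. Qed.
Lemma h_mem_tensr n m n' m' (x : P n m) (f : P n' m') :
  h_mem x -> h_mem (x \ox f).
Proof. by move=> [u ->]; exists (u \ox f); rewrite tensZl. Qed.

Definition h_ideal : ideal P := MkIdeal h_mem0 h_mem_lin h_mem_compl
  h_mem_compr h_mem_tensl h_mem_tensr.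

End HIdeal.

Lemma h_dec k n m (x : P n m) : h_ideal k.+1 n m x -> h_ideal k n m x.
Proof. by move=> [u ->]; exists (hbar *: u); rewrite scalerA exprSr. Qed.

Definition h_filtration : filtration P := MkFiltration h_dec.

Section Closure.
Variable I : ideal P.

Definition closure_mem n m (x : P n m) :=
  forall k, exists2 y, I n m y & h_mem k (x - y).

Lemma closure0 n m : closure_mem (0 : P n m).
Proof.
by move=> k; exists 0; [apply: ideal0 | rewrite subrr; apply: h_mem0].
Qed.
Lemma closure_lin n m a (x y : P n m) :
  closure_mem x -> closure_mem y -> closure_mem (a *: x + y).
Proof.
move=> cx cy k; have [u Iu hu] := cx k; have [v Iv hv] := cy k.
exists (a *: u + v); first exact: ideal_lin.
by rewrite opprD addrACA -scalerBr; apply: h_mem_lin.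
Qed.
Lemma closure_compl n m p (f : P m p) (x : P n m) :
  closure_mem x -> closure_mem (f \co x).
Proof.
move=> cx k; have [u Iu hu] := cx k; exists (f \co u).
  exact: ideal_compl.
by rewrite -compNr -compDr; apply: h_mem_compl.
Qed.
Lemma closure_compr n m p (x : P m p) (f : P n m) :
  closure_mem x -> closure_mem (x \co f).
Proof.
move=> cx k; have [u Iu hu] := cx k; exists (u \co f).
  exact: ideal_compr.
by rewrite -compNl -compDl; apply: h_mem_compr.
Qed.
Lemma closure_tensl n m n' m' (f : P n m) (x : P n' m') :
  closure_mem x -> closure_mem (f \ox x).
Proof.
move=> cx k; have [u Iu hu] := cx k; exists (f \ox u).
  exact: ideal_tensl.
by rewrite -tensNr -tensDr; apply: h_mem_tensl.
Qed.
Lemma closure_tensr n m n' m' (x : P n m) (f : P n' m') :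
  closure_mem x -> closure_mem (x \ox f).
Proof.
move=> cx k; have [u Iu hu] := cx k; exists (u \ox f).
  exact: ideal_tensr.
by rewrite -tensNl -tensDl; apply: h_mem_tensr.
Qed.

Definition closure_ideal : ideal P := MkIdeal closure0 closure_lin closure_compl
  closure_compr closure_tensl closure_tensr.

End Closure.

Lemma closure_idealS (I J : ideal P) :
  (forall n m (x : P n m), I n m x -> J n m x) ->
  forall n m (x : P n m), closure_ideal I n m x -> closure_ideal J n m x.
Proof.
by move=> IJ n m x cx k; have [y Iy hy] := cx k; exists y => //; apply: IJ.
Qed.

Definition torsion_mem n m (x : P n m) :=
  exists2 a : pseries K, a != 0 & a *: x = 0.

Lemma pseries_mul_neq0 (a b : pseries K) : a != 0 -> b != 0 -> a * b != 0.
Proof.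
have nz (c : pseries K) : c != 0 -> exists i, c i != 0.
  move=> c0; apply: contrapT => h; move/eqP: c0; apply; apply: pseriesP => i.
  rewrite /= if_same; apply/eqP; apply: contrapT => ci.
  by apply: h; exists i; apply/negP.
move=> /nz ea /nz eb.
case: (ex_minnP ea) => i ai mini; case: (ex_minnP eb) => j bj minj.
apply/eqP => /(congr1 (fun c : pseries K => c (i + j)%N)).
rewrite pmulE /= if_same /conv.
have hi : (i < (i + j).+1)%N by rewrite ltnS leq_addr.
rewrite (bigD1 (Ordinal hi)) //= addKn big1 => [|l /eqP li].
  by rewrite addr0; apply/eqP; rewrite mulf_neq0.
have [lt_li|ge_li] := ltnP l i.
  have : ~~ (a l != 0) by apply/negP => /mini; rewrite leqNgt lt_li.
  by rewrite negbK => /eqP ->; rewrite mul0r.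
have lt_il : (i < l)%N.
  rewrite ltn_neqAle ge_li andbT; apply/negP => /eqP e; apply: li.
  exact: val_inj.
have : ~~ (b (i + j - l)%N != 0).
  apply/negP => /minj; rewrite leqNgt => /negP; apply.
  rewrite ltn_subLR; last by rewrite -ltnS.
  by rewrite ltn_add2r.
by rewrite negbK => /eqP ->; rewrite mulr0.
Qed.

Lemma torsion0 n m : torsion_mem (0 : P n m).
Proof. by exists 1; [apply: oner_neq0 | rewrite scaler0]. Qed.
Lemma torsion_lin n m c (x y : P n m) :
  torsion_mem x -> torsion_mem y -> torsion_mem (c *: x + y).
Proof.
move=> [a a0 ax] [b b0 bx]; exists (a * b); first exact: pseries_mul_neq0.
rewrite scalerDr -[in X in _ + X]scalerA bx scaler0 addr0.
by rewrite scalerA -mulrA [a * _]mulrC -scalerA ax scaler0.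
Qed.
Lemma torsion_compl n m p (f : P m p) (x : P n m) :
  torsion_mem x -> torsion_mem (f \co x).
Proof. by move=> [a a0 ax]; exists a; rewrite // -compZr ax comp0r. Qed.
Lemma torsion_compr n m p (x : P m p) (f : P n m) :
  torsion_mem x -> torsion_mem (x \co f).
Proof. by move=> [a a0 ax]; exists a; rewrite // -compZl ax comp0l. Qed.
Lemma torsion_tensl n m n' m' (f : P n m) (x : P n' m') :
  torsion_mem x -> torsion_mem (f \ox x).
Proof. by move=> [a a0 ax]; exists a; rewrite // -tensZr ax tens0r. Qed.
Lemma torsion_tensr n m n' m' (x : P n m) (f : P n' m') :
  torsion_mem x -> torsion_mem (x \ox f).
Proof. by move=> [a a0 ax]; exists a; rewrite // -tensZl ax tens0l. Qed.

Definition torsion_ideal : ideal P := MkIdeal torsion0 torsion_lin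
  torsion_compl torsion_compr torsion_tensl torsion_tensr.

Definition mod_h : prop K := restrict_prop (quot_prop (h_ideal 1)).

Definition cls_h n m (x : P n m) : mod_h n m := cls (h_ideal 1) n m x.

End HbarIdeals.

(* The reduction modulo hbar of a morphism P -> U[[hbar]]; U[[hbar]]/(hbar) is
   identified with U by taking constant terms. *)
Section ModH.
Variables (K : fieldType) (P : prop (pseries K)) (U : prop K).
Variable F : prop_mor P (pseries_prop U).

Definition modh_fun n m (x : mod_h P n m) : U n m :=
  pcoef (F n m (qrepr (x : qhom (h_ideal P 1) n m))) 0.

Lemma hbar_coef0 (V : lmodType K) (x : pseries V) : (hbar *: x) 0 = 0.
Proof. by rewrite pscaleE /conv big_ord1 /= scale0r. Qed.

Lemma modh_funE n m (x : P n m) : modh_fun (cls_h x) = pcoef (F n m x) 0.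
Proof.
have [y e] := pi_repr (h_ideal P 1) x.
have er : qrepr (pi (h_ideal P 1) x) = x + hbar *: y.
  by rewrite -[hbar]expr1 -e addrC subrK.
change (pcoef (F n m (qrepr (pi (h_ideal P 1) x))) 0 = pcoef (F n m x) 0).
by rewrite er linearD linearZ pcoefD hbar_coef0 addr0.
Qed.

Lemma cls_hP n m (x : mod_h P n m) : exists y, x = cls_h y.
Proof.
exists (qrepr (x : qhom (h_ideal P 1) n m)).
exact: (esym (qreprK _)).
Qed.

Lemma modh_lin n m : linear (@modh_fun n m).
Proof.
move=> a x y; have [u ->] := cls_hP x; have [v ->] := cls_hP y.
have -> : a *: cls_h u + cls_h v = cls_h (pconst a *: u + v).
  by rewrite /cls_h linearP.
rewrite !modh_funE linearP pcoefD pscaleE; congr (_ + _).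
by rewrite (conv_constl a (F n m u) (op := *:%R)) // => w; rewrite scale0r.
Qed.

HB.instance Definition _ n m :=
  GRing.isLinear.Build K (mod_h P n m) (U n m) _ (@modh_fun n m)
    (@modh_lin n m).

Lemma modh_id n : modh_fun (idp n) = idp n.
Proof.
have -> : idp n = cls_h (idp n) :> mod_h P n n by [].
by rewrite modh_funE mor_id.
Qed.
Lemma modh_sym n (s : 'S_n) : modh_fun (sym s) = sym s.
Proof.
have -> : sym s = cls_h (sym s) :> mod_h P n n by [].
by rewrite modh_funE mor_sym.
Qed.
Lemma modh_comp n m p (f : mod_h P m p) (g : mod_h P n m) :
  modh_fun (f \co g) = modh_fun f \co modh_fun g.
Proof.
have [u ->] := cls_hP f; have [v ->] := cls_hP g.
have -> : cls_h u \co cls_h v = cls_h (u \co v) by rewrite /cls_h mor_comp.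
by rewrite !modh_funE mor_comp /= /conv big_ord1.
Qed.
Lemma modh_tens n m n' m' (f : mod_h P n m) (g : mod_h P n' m') :
  modh_fun (f \ox g) = modh_fun f \ox modh_fun g.
Proof.
have [u ->] := cls_hP f; have [v ->] := cls_hP g.
have -> : cls_h u \ox cls_h v = cls_h (u \ox v) by rewrite /cls_h mor_tens.
by rewrite !modh_funE mor_tens /= /conv big_ord1.
Qed.

Definition mod_h_mor : prop_mor (mod_h P) U :=
  @PropMor _ _ _ (fun n m => @modh_fun n m : {linear mod_h P n m -> U n m})
    modh_id modh_comp modh_tens modh_sym.

End ModH.

Record bialg_ops (R : comNzRingType) (P : prop R) := BialgOps {
  om : P 2 1;
  od : P 1 2;
  oeta : P 0 1;
  oeps : P 1 0
}.

Definition map_ops (R S : comNzRingType) (P : prop R) (Q : prop S)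
    (f : forall n m, P n m -> Q n m) (o : bialg_ops P) : bialg_ops Q :=
  BialgOps (f 2 1 (om o)) (f 1 2 (od o)) (f 0 1 (oeta o)) (f 1 0 (oeps o)).

(* For s the concatenation of I_1, ..., I_p and x = x_1 (x) ... (x) x_p of
   bidegree (0, n), [place s x] is x_1^{I_1} ... x_p^{I_p}. *)
Definition place (R : comNzRingType) (P : prop R) n k (s : seq nat)
  (x : P k n) : P k n := sym (oneline n s) \co x.

Arguments place {R P n k}.

(* A relation f = g is represented by the element f - g to be killed. *)
Section Relations.
Variables (R : comNzRingType) (P : prop R) (o : bialg_ops P).

Local Notation m := (om o).
Local Notation D := (od o).
Local Notation eta := (oeta o).
Local Notation eps := (oeps o).
Local Notation id1 := (idp 1 : P 1 1).
Local Notation s1324 := (sym (oneline 4 [:: 1; 3; 2; 4]%N) : P 4 4).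
Local Notation s3124 := (sym (oneline 4 [:: 3; 1; 2; 4]%N) : P 4 4).
Local Notation s21 := (sym (oneline 2 [:: 2; 1]%N) : P 2 2).

Inductive bialg_rel : forall a b, P a b -> Prop :=
| Rel_assoc : bialg_rel (m \co (m \ox id1) - m \co (id1 \ox m) : P 3 1)
| Rel_unitl : bialg_rel (m \co (eta \ox id1) - id1 : P 1 1)
| Rel_unitr : bialg_rel (m \co (id1 \ox eta) - id1 : P 1 1)
| Rel_coassoc : bialg_rel ((D \ox id1) \co D - (id1 \ox D) \co D : P 1 3)
| Rel_counitl : bialg_rel ((eps \ox id1) \co D - id1 : P 1 1)
| Rel_counitr : bialg_rel ((id1 \ox eps) \co D - id1 : P 1 1)
| Rel_Dm : bialg_rel (D \co m - (m \ox m) \co s1324 \co (D \ox D) : P 2 2)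
| Rel_Deta : bialg_rel (D \co eta - eta \ox eta : P 0 2)
| Rel_epsm : bialg_rel (eps \co m - eps \ox eps : P 2 0)
| Rel_epseta : bialg_rel (eps \co eta - idp 0 : P 0 0).

Inductive coco_rel : forall a b, P a b -> Prop :=
| Rel_coco : coco_rel (D - s21 \co D : P 1 2).

Inductive qt_rel (r : P 0 2) : forall a b, P a b -> Prop :=
| Rel_qt1 : qt_rel r ((D \ox id1) \co r
    - (place [:: 1; 3; 2]%N (r \ox eta)
       + place [:: 1; 2; 3]%N (eta \ox r)) : P 0 3)
| Rel_qt2 : qt_rel r ((id1 \ox D) \co r
    - (place [:: 1; 3; 2]%N (r \ox eta)
       + place [:: 1; 2; 3]%N (r \ox eta)) : P 0 3)
| Rel_qt3 (t := r + s21 \co r) :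
    qt_rel r ((m \ox m) \co s1324 \co (t \ox D)
              - (m \ox m) \co s1324 \co (D \ox t) : P 1 2)
| Rel_cybe (mu := m - m \co s21) :
    qt_rel r (((mu \ox id1 \ox id1) \co place [:: 1; 3; 2; 4]%N (r \ox r)
              + (id1 \ox mu \ox id1) \co place [:: 1; 2; 3; 4]%N (r \ox r)
              + (id1 \ox id1 \ox mu) \co place [:: 1; 3; 2; 4]%N (r \ox r))
             : P 0 3).

Inductive QT_rel (T T' : P 0 2) : forall a b, P a b -> Prop :=
| Rel_QT1 : QT_rel T T' ((D \ox id1) \co T
    - (id1 \ox id1 \ox m) \co place [:: 1; 3; 2; 4]%N (T \ox T) : P 0 3)
| Rel_QT2 : QT_rel T T' ((id1 \ox D) \co T
    - (m \ox id1 \ox id1) \co place [:: 1; 4; 2; 3]%N (T \ox T) : P 0 3)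
| Rel_QT3 : QT_rel T T' ((m \ox m) \co s3124 \co (D \ox T)
    - (m \ox m) \co s1324 \co (T \ox D) : P 1 2)
| Rel_QT4 : QT_rel T T' ((m \ox m) \co s1324 \co (T \ox T')
    - eta \ox eta : P 0 2).

Fixpoint tpow (f : P 1 1) (p : nat) : P p p :=
  match p with 0 => idp 0 | q.+1 => f \ox tpow f q end.

(* Delta^{(0)} = eps, and Delta^{(1)} = id by the counit relation *)
Fixpoint iter_cop (p : nat) : P 1 p :=
  match p with 0 => eps | q.+1 => (id1 \ox iter_cop q) \co D end.

Inductive aug_rel (n : nat) : forall a b, P a b -> Prop :=
| Rel_aug p : (n <= p)%N ->
    aug_rel n (tpow (id1 - eta \co eps) p \co iter_cop p : P 1 p).

Lemma aug_relS n a b (x : P a b) : aug_rel n.+1 x -> aug_rel n x.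
Proof. by case=> p np; apply: Rel_aug; apply: ltnW. Qed.

End Relations.

Inductive qcoco_rel (K : fieldType) (P : prop (pseries K)) (o : bialg_ops P)
    (T : P 0 2) (delta : P 1 2) (Tt : P 0 2) : forall a b, P a b -> Prop :=
| Rel_qcoco1 : qcoco_rel o T delta Tt
    (od o - sym (oneline 2 [:: 2; 1]%N) \co od o - hbar *: delta)
| Rel_qcoco2 : qcoco_rel o T delta Tt
    (T - (oeta o \ox oeta o + hbar *: Tt)).

Inductive bialg_gen : nat -> nat -> Type :=
| Gm : bialg_gen 2 1
| Gd : bialg_gen 1 2
| Geta : bialg_gen 0 1
| Geps : bialg_gen 1 0.

Inductive qt_gen : nat -> nat -> Type := Gr : qt_gen 0 2.

Inductive QT_gen : nat -> nat -> Type :=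
| GR : QT_gen 0 2
| GRinv : QT_gen 0 2.

Inductive qcoco_gen : nat -> nat -> Type :=
| Gdelta : qcoco_gen 1 2
| GRtilde : qcoco_gen 0 2.

Section Props.
Variable K : fieldType.

Definition free_bialg : prop K := free_prop K bialg_gen.
Definition free_ops : bialg_ops free_bialg :=
  BialgOps (fgen K Gm) (fgen K Gd) (fgen K Geta) (fgen K Geps).

Definition Bialg : prop K := quot_prop (ideal_gen (bialg_rel free_ops)).
Definition Bialg_ops : bialg_ops Bialg :=
  map_ops (fun n m => cls _ n m) free_ops.

Definition Bialg_coco : prop K := quot_prop (ideal_gen (coco_rel Bialg_ops)).
Definition Bialg_coco_ops : bialg_ops Bialg_coco :=
  map_ops (fun n m => cls _ n m) Bialg_ops.

Definition coco_adj : prop K := adjoin Bialg_coco qt_gen.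
Definition coco_adj_ops : bialg_ops coco_adj :=
  map_ops (adj_base qt_gen) Bialg_coco_ops.
Definition coco_adj_r : coco_adj 0 2 := adj_gen Bialg_coco Gr.

Definition Bialg_coco_qt : prop K :=
  quot_prop (ideal_gen (qt_rel coco_adj_ops coco_adj_r)).
Definition Bialg_coco_qt_ops : bialg_ops Bialg_coco_qt :=
  map_ops (fun n m => cls _ n m) coco_adj_ops.
Definition Bialg_coco_qt_r : Bialg_coco_qt 0 2 := cls _ 0 2 coco_adj_r.

Lemma I'_dec k n m (x : Bialg_coco_qt n m) :
  ideal_gen (aug_rel Bialg_coco_qt_ops k.+1) n m x ->
  ideal_gen (aug_rel Bialg_coco_qt_ops k) n m x.
Proof. exact/ideal_genS/aug_relS. Qed.

Definition I' : filtration Bialg_coco_qt := MkFiltration I'_dec.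

Definition UE_qt : prop K := completion I'.
Definition UE_qt_ops : bialg_ops UE_qt :=
  map_ops (to_completion I') Bialg_coco_qt_ops.
Definition UE_qt_r : UE_qt 0 2 := to_completion I' Bialg_coco_qt_r.

Definition QT_adj : prop K := adjoin Bialg QT_gen.
Definition QT_adj_ops : bialg_ops QT_adj :=
  map_ops (adj_base QT_gen) Bialg_ops.

Definition Bialg_QT : prop K :=
  quot_prop (ideal_gen
    (QT_rel QT_adj_ops (adj_gen Bialg GR) (adj_gen Bialg GRinv))).
Definition Bialg_QT_ops : bialg_ops Bialg_QT :=
  map_ops (fun n m => cls _ n m) QT_adj_ops.
Definition Bialg_QT_R : Bialg_QT 0 2 := cls _ 0 2 (adj_gen Bialg GR).

(* Generators are adjoined in the category of hbar-adically complete and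
   separated K[[hbar]]-modules, i.e. of quotients of topologically free modules
   by closed submodules: the algebraic adjunction is completed hbar-adically,
   and only closed ideals are divided out. *)
Definition qcoco_adj_alg : prop (pseries K) :=
  adjoin (pseries_prop Bialg_QT) qcoco_gen.
Definition qcoco_adj : prop (pseries K) :=
  completion (h_filtration qcoco_adj_alg).
Definition to_qcoco_adj n m (x : Bialg_QT n m) : qcoco_adj n m :=
  to_completion (h_filtration qcoco_adj_alg)
    (adj_base qcoco_gen (pconst x : pseries_prop Bialg_QT n m)).
Definition qcoco_adj_ops : bialg_ops qcoco_adj :=
  map_ops to_qcoco_adj Bialg_QT_ops.
Definition qcoco_adj_delta : qcoco_adj 1 2 :=
  to_completion (h_filtration qcoco_adj_alg) (adj_gen _ Gdelta).
Definition qcoco_adj_Rtilde : qcoco_adj 0 2 :=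
  to_completion (h_filtration qcoco_adj_alg) (adj_gen _ GRtilde).

Definition qcoco_quot : prop (pseries K) := quot_prop (closure_ideal
  (ideal_gen (qcoco_rel qcoco_adj_ops (to_qcoco_adj Bialg_QT_R)
                        qcoco_adj_delta qcoco_adj_Rtilde))).
Definition to_qcoco_quot n m : qcoco_adj n m -> qcoco_quot n m := cls _ n m.

Definition Bialg_qcoco_QT : prop (pseries K) :=
  quot_prop (closure_ideal (torsion_ideal qcoco_quot)).
Definition to_Bialg_qcoco_QT n m (x : qcoco_adj n m) : Bialg_qcoco_QT n m :=
  cls _ n m (to_qcoco_quot x).
Definition Bialg_qcoco_QT_ops : bialg_ops Bialg_qcoco_QT :=
  map_ops to_Bialg_qcoco_QT qcoco_adj_ops.
Definition Bialg_qcoco_QT_Rtilde : Bialg_qcoco_QT 0 2 :=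
  to_Bialg_qcoco_QT qcoco_adj_Rtilde.

Lemma J'_dec k n m (x : Bialg_qcoco_QT n m) :
  closure_ideal (ideal_gen (aug_rel Bialg_qcoco_QT_ops k.+1)) n m x ->
  closure_ideal (ideal_gen (aug_rel Bialg_qcoco_QT_ops k)) n m x.
Proof. exact/closure_idealS/ideal_genS/aug_relS. Qed.

Definition J' : filtration Bialg_qcoco_QT := MkFiltration J'_dec.

Definition QUE_QT : prop (pseries K) := completion J'.
Definition QUE_QT_ops : bialg_ops QUE_QT :=
  map_ops (to_completion J') Bialg_qcoco_QT_ops.
Definition QUE_QT_Rtilde : QUE_QT 0 2 := to_completion J' Bialg_qcoco_QT_Rtilde.

(* The last but one condition is continuity for the inverse limit topologies:
   the elements with zero k-th component form a basis of neighbourhoods of 0. *)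
Record is_SC (SC : prop_mor UE_qt (mod_h QUE_QT)) : Prop := IsSC {
  SC_ops : map_ops (fun n m => SC n m) UE_qt_ops =
    map_ops (@cls_h K QUE_QT) QUE_QT_ops;
  SC_r : SC 0 2 UE_qt_r = cls_h QUE_QT_Rtilde;
  SC_cont : forall n m k, exists l, forall x : UE_qt n m, x l = 0 ->
    exists2 y : QUE_QT n m, y k = 0 & SC n m x = cls_h y;
  SC_surj : forall n m (y : mod_h QUE_QT n m), exists x, SC n m x = y
}.

Definition is_quantization (SC : prop_mor UE_qt (mod_h QUE_QT))
    (Q : prop_mor QUE_QT (pseries_prop UE_qt)) : Prop :=
  forall n m (x : UE_qt n m), mod_h_mor Q n m (SC n m x) = x.

End Props.

(* Main.v *)
From HB Require Import structures.
From mathcomp Require Import all_boot all_algebra perm.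
From mathcomp Require Import boolp.
Require Import Defs.

(** The composite [(Q mod hbar) o SC = id] with [SC] onto makes [Q mod hbar]
    bijective.  A [K[[hbar]]]-linear map which is bijective modulo [hbar], from
    an hbar-adically complete and separated module to a module of power series,
    is bijective: preimages are built by successive approximation, and the
    kernel lies in the intersection of the [hbar^k M] because the target has no
    torsion.  The modules of [QUE_QT] are complete and separated: completeness
    is inherited from the completed adjunction by all quotients, the quotients
    by closed ideals are separated, and both properties pass to the inverse
    limit since sums of series in separated modules are unique. *)

Set Implicit Arguments.
Unset Strict Implicit.
Unset Printing Implicit Defensive.

Import GRing.Theory.
Local Open Scope ring_scope.
Local Open Scope prop_scope.

Section HbarAdic.
Variable K : fieldType.
Implicit Types M N : lmodType (pseries K).

Definition hbar_separated M :=
  forall x : M, (forall k, exists y, x = hbar ^+ k *: y) -> x = 0.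

(* [y k] stands for the sum of the series [x k + hbar x (k+1) + ...]; without
   separatedness such sums exist but need not be unique. *)
Definition hbar_complete M :=
  forall x : nat -> M, exists y : nat -> M,
    forall k, y k = x k + hbar *: y k.+1.

(** A sum of arbitrary lifts maps to a sum; this is why [hbar_complete] asks only for existence. *)
Lemma hbar_complete_surj M N (f : {linear M -> N}) :
  (forall y, exists x, f x = y) -> hbar_complete M -> hbar_complete N.
Proof.
move=> fS cM x; have [x' ex'] := choice (fun k => fS (x k)).
have [y ey] := cM x'; exists (fun k => f (y k)) => k.
by rewrite {1}ey linearD linearZ /= ex'.
Qed.

(** Iteration gives [d k = hbar ^+ l *: d (k + l)] for every [l]. *)
Lemma hbar_sep_seq0 M (d : nat -> M) :
  hbar_separated M -> (forall k, d k = hbar *: d k.+1) -> forall k, d k = 0.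
Proof.
move=> sM dE k; apply: sM => l; exists (d (k + l)%N).
elim: l => [|l IHl]; first by rewrite expr0 scale1r addn0.
by rewrite IHl {1}dE scalerA exprSr addnS.
Qed.

Lemma hbar_sum_unique M (x y z : nat -> M) : hbar_separated M ->
  (forall k, y k = x k + hbar *: y k.+1) ->
  (forall k, z k = x k + hbar *: z k.+1) -> forall k, y k = z k.
Proof.
move=> sM ey ez k; apply/eqP; rewrite -subr_eq0; apply/eqP.
apply: (@hbar_sep_seq0 M (fun k => y k - z k) sM) => {}k.
by rewrite {1}ey {1}ez opprD addrACA subrr add0r -scalerBr.
Qed.

Variable V : lmodType K.

Lemma pcoef0 k : (0 : pseries V) k = 0.
Proof. exact: if_same. Qed.

(* [hbar_coef0] of Defs is stated at the zero of the semiring [nat]. *)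
Lemma hbar_coefO (x : pseries V) : (hbar *: x) 0%N = 0.
Proof. exact: hbar_coef0. Qed.

Lemma hbar_coefS (x : pseries V) k : (hbar *: x) k.+1 = x k.
Proof.
rewrite pscaleE /conv 2!big_ord_recl /= scale0r add0r scale1r.
rewrite big1 ?addr0 => [|i _]; last by rewrite scale0r.
by rewrite subSS subn0.
Qed.

Lemma hbar_divE (x : pseries V) :
  x 0%N = 0 -> x = hbar *: PSeries (fun k => x k.+1).
Proof.
by move=> x0; apply: pseriesP => -[|k]; rewrite ?hbar_coefO ?hbar_coefS.
Qed.

Lemma hbar_inj (x : pseries V) : hbar *: x = 0 -> x = 0.
Proof.
move=> hx; apply: pseriesP => k; by rewrite -hbar_coefS hx !pcoef0.
Qed.

Variables (M : lmodType (pseries K)) (f : {linear M -> pseries V}).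

(** If [f (hbar *: z) = 0] then [f z = 0], so an element of the kernel can be divided by [hbar]
    again and again inside the kernel. *)
Lemma hbar_lift_inj : hbar_separated M ->
  (forall x, f x 0%N = 0 -> exists y, x = hbar *: y) ->
  forall x, f x = 0 -> x = 0.
Proof.
move=> sM f0 x fx; apply: sM => k.
suff [y [-> _]] : exists y, x = hbar ^+ k *: y /\ f y = 0 by exists y.
elim: k => [|k [y [-> fy]]]; first by exists x; rewrite expr0 scale1r.
have [z yE] : exists z, y = hbar *: z by apply: f0; rewrite fy pcoef0.
exists z; split; first by rewrite yE scalerA exprSr.
by apply: hbar_inj; rewrite -linearZ -yE.
Qed.

Lemma hbar_lift_surj : hbar_complete M ->
  (forall v, exists x, f x 0%N = v) -> forall z, exists x, f x = z.
Proof.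
move=> cM f0 z; have [s sE] := choice f0.
(* The remainder [u - f (s (u 0))] has zero constant term by the choice of [s]; [next] divides it by
   [hbar]. *)
pose next (u : pseries V) := PSeries (fun k => (u - f (s (u 0%N))) k.+1).
pose u k := iter k next z.
have uE k : u k = f (s (u k 0%N)) + hbar *: u k.+1.
  by apply/eqP; rewrite addrC -subr_eq; apply/eqP/hbar_divE;
     rewrite pcoefD /= sE subrr.
have [y ey] := cM (fun k => s (u k 0%N)); exists (y 0%N).
have fyE k : f (y k) = f (s (u k 0%N)) + hbar *: f (y k.+1).
  by rewrite {1}ey linearD linearZ.
(* [f (y k)] and [u k] obey the same recursion, which reduces coefficient [l.+1] at [k] to
   coefficient [l] at [k.+1]; hence the induction on [l] for all [k]. *)
apply/pseriesP => l; rewrite -[z]/(u 0%N); move: l 0%N.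
elim=> [|l IHl] k; rewrite fyE [in RHS]uE !pcoefD.
  by rewrite !hbar_coefO.
by rewrite !hbar_coefS IHl.
Qed.

End HbarAdic.

Section Modules.
Variables (K : fieldType) (P : prop (pseries K)).

Lemma quot_hbar_complete (I : ideal P) n m :
  hbar_complete (P n m) -> hbar_complete (quot_prop I n m).
Proof.
apply: (hbar_complete_surj (f := cls I n m)) => y.
by exists (qrepr y); apply: qreprK.
Qed.

(** A representative of [x] is [hbar ^+ k *: y'] plus an element of the closure, which lies in [I]
    up to a multiple of [hbar ^+ k]. So it is in [I] up to [hbar ^+ k] for every [k], that is, in
    the closure. *)
Lemma quot_closure_separated (I : ideal P) n m :
  hbar_separated (quot_prop (closure_ideal I) n m).
Proof.
move=> x hx; pose J := closure_ideal I; pose x' : P n m := qrepr x.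
have ex : pi J x' = x by apply: qreprK.
suff: J n m (x' - 0) by move/piP; rewrite ex => ->; apply: linear0.
rewrite subr0 => k; have [y ey] := hx k; pose y' : P n m := qrepr y.
have eyx : pi J x' = pi J (hbar ^+ k *: y').
  by rewrite ex ey [RHS]linearZ /=; congr (_ *: _); rewrite qreprK.
have /piP/(_ k)[j Ij [w ew]] := eyx.
exists j => //; exists (y' + w).
by rewrite scalerDr -ew [RHS]addrC [RHS]addrAC subrK.
Qed.

Lemma completion_scaleE (I : filtration P) n m a (x : completion I n m) k :
  (a *: x) k = a *: x k.
Proof. by rewrite -[a *: x]addr0 chom_linE addr0. Qed.

Lemma completion_addE (I : filtration P) n m (x y : completion I n m) k :
  (x + y) k = x k + y k.
Proof. by rewrite -[x]scale1r chom_linE !scale1r. Qed.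

Lemma completion_separated (I : filtration P) n m :
  (forall k, hbar_separated (quot_prop (I k) n m)) ->
  hbar_separated (completion I n m).
Proof.
move=> sI x hx; apply: chomP => k; apply: sI => l.
by have [y ->] := hx l; exists (y k); rewrite completion_scaleE.
Qed.

Lemma completion_complete (I : filtration P) n m :
  (forall k, hbar_separated (quot_prop (I k) n m)) ->
  (forall k, hbar_complete (quot_prop (I k) n m)) ->
  hbar_complete (completion I n m).
Proof.
move=> sI cI x.
pose y k := sval (cid (cI k (fun l => x l k))).
have yE k : forall l, y k l = x l k + hbar *: y k l.+1.
  exact: (svalP (cid (cI k (fun l => x l k)))).
have cy l : compatible (fun k => y k l).
  apply/compatibleP => k; move: l.
  (* [trans] sends the sums at level [k.+1] to sums of the level [k] series, which are unique. *)
  apply: (hbar_sum_unique (x := fun l => x l k) (sI k)) => l; last exact: yE.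
  by rewrite yE addrC trans_lin chomE addrC.
exists (fun l => CHom (cy l)) => l; apply: chomP => k.
by rewrite completion_addE completion_scaleE; apply: yE.
Qed.

Lemma trans0 (I : filtration P) k n m :
  trans (0 : quot_prop (I k.+1) n m) = 0.
Proof. by rewrite -(linear0 (cls (I k.+1) n m)) trans_cls linear0. Qed.

Lemma trans_scale (I : filtration P) k n m a (x : quot_prop (I k.+1) n m) :
  trans (a *: x) = a *: trans x.
Proof. by rewrite -[_ *: x]addr0 trans_lin trans0 addr0. Qed.

Lemma h_completion_complete n m :
  hbar_complete (completion (h_filtration P) n m).
Proof.
move=> x.
(* Modulo [hbar ^+ k] the series from index [l] on is its first [k] terms. *)
pose y l k := \sum_(i < k) hbar ^+ i *: x (l + i)%N k.
have h0 k (u : quot_prop (h_filtration P k) n m) : hbar ^+ k *: u = 0.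
  rewrite (clsE u) -linearZ -[RHS](linear0 (cls (h_filtration P k) n m)).
  by apply/piP; rewrite subr0; exists (qrepr u).
(* The vanishing extra term absorbs the shift of length both under [trans] and in the recursion on
   [l]. *)
have yE l k : y l k = \sum_(i < k.+1) hbar ^+ i *: x (l + i)%N k.
  by rewrite big_ord_recr /= h0 addr0.
have cy l : compatible (y l).
  apply/compatibleP => k; rewrite (yE l k) /y.
  rewrite (big_morph (@trans _ _ _ k n m) (op1 := +%R) (id1 := 0)).
  - by apply: eq_bigr => i _; rewrite trans_scale chomE.
  - by move=> u v; rewrite -[u]scale1r trans_lin !scale1r.
  - exact: trans0.
exists (fun l => CHom (cy l)) => l; apply: chomP => k.
rewrite completion_addE completion_scaleE.
change (y l k = x l k + hbar *: y l.+1 k).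
rewrite yE big_ord_recl expr0 scale1r addn0 scaler_sumr; congr (_ + _).
by apply: eq_bigr => i _; rewrite scalerA exprS addSnnS.
Qed.

End Modules.

(** The inverse map is a prop morphism because both sides of each required identity have the same
    image under the injective [F]. *)
Lemma prop_iso_bij (R : comNzRingType) (P Q : prop R) (F : prop_mor P Q) :
  (forall n m x, F n m x = 0 -> x = 0) ->
  (forall n m y, exists x, F n m x = y) -> prop_iso F.
Proof.
move=> F0 FS.
have FI n m : injective (F n m).
  by move=> x y e; apply/eqP; rewrite -subr_eq0; apply/eqP/F0;
     rewrite linearB /= e subrr.
pose g n m (y : Q n m) : P n m := sval (cid (FS n m y)).
have gK n m y : F n m (g n m y) = y by exact: (svalP (cid (FS n m y))).
have gL n m : linear (g n m).
  by move=> a x y; apply: FI; rewrite linearP !gK.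
pose G n m : {linear Q n m -> P n m} :=
  HB.pack (g n m) (GRing.isLinear.Build _ _ _ _ (g n m) (gL n m)).
have Gid n : G n n (idp n) = idp n by apply: FI; rewrite gK mor_id.
have Gcomp n m p (u : Q m p) (v : Q n m) :
    G n p (u \co v) = G m p u \co G n m v.
  by apply: FI; rewrite mor_comp !gK.
have Gtens n m n' m' (u : Q n m) (v : Q n' m') :
    G (n + n')%N (m + m')%N (u \ox v) = G n m u \ox G n' m' v.
  by apply: FI; rewrite mor_tens !gK.
have Gsym n (s : 'S_n) : G n n (sym s) = sym s by apply: FI; rewrite gK mor_sym.
exists (PropMor Gid Gcomp Gtens Gsym); split=> n m x; last exact: gK.
by apply: FI; apply: gK.
Qed.

Section QUE.
Variables (K : fieldType) (n m : nat).

Lemma QUE_separated : hbar_separated (QUE_QT K n m).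
Proof. by apply: completion_separated => k; apply: quot_closure_separated. Qed.

Lemma QUE_complete : hbar_complete (QUE_QT K n m).
Proof.
apply: completion_complete => k; first exact: quot_closure_separated.
(* The quotients are by [J' k], by the closed torsion ideal and by the closed ideal of the
   [qcoco_rel] relations. *)
do 3!apply: quot_hbar_complete; exact: h_completion_complete.
Qed.

End QUE.

Theorem proposition5p1 (K : fieldType) (charK : [pchar K]%R =i pred0)
    (SC : prop_mor (UE_qt K) (mod_h (QUE_QT K))) (hSC : is_SC SC)
    (Q : prop_mor (QUE_QT K) (pseries_prop (UE_qt K)))
    (hQ : is_quantization SC Q) :
  prop_iso Q.
Proof.
apply: prop_iso_bij => n m.
- apply: hbar_lift_inj; first exact: QUE_separated.
  (* Since [SC] is onto, its left inverse, [Q] modulo [hbar], is injective. *)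
  move=> x Qx0; have [u SCu] := SC_surj hSC (cls_h x).
  have u0 : u = 0 by rewrite -(hQ n m u) SCu -Qx0; apply: modh_funE.
  have /piP[y] : cls_h x = cls_h 0 by rewrite -SCu u0 /cls_h !linear0.
  by rewrite subr0 expr1 => ->; exists y.
- apply: hbar_lift_surj; first exact: QUE_complete.
  (* Any representative of [SC v] is sent by [Q] to a series with constant term [v]. *)
  move=> v; have [x SCv] := cls_hP (SC n m v); exists x.
  by rewrite -[RHS](hQ n m v) SCv; apply/esym/modh_funE.
Qed.
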